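(* Consider the linear system, costs, disturbance-action controller (DAC) class and POC algorithm described in the context, and suppose Assumptions (i), (ii), (iii) stated there hold. Let $\delta=\frac1L$, $0<\eta\le\frac1L$, $\rho=\sqrt{1-\mu\eta}$, $\lambda=(H+2)^2L_f$, and choose the memory and prediction horizons as $$H=\lceil c_H\log T\rceil,\qquad W=\lceil c_W\log T\rceil,\qquad c_H\ge\frac1{|\log(1-\gamma)|},\qquad c_W\ge\frac1{|\log\rho|}.$$ Let $(x_t,u_t)$ be the trajectory generated by the POC algorithm, let $M_1^*,\dots,M_T^*\in\mathcal M$ be an arbitrary comparator sequence, $\pi_t=\pi(K,M_t^* )$, $(x_t^{\pi_t},u_t^{\pi_t})$ the trajectory of this time-varying sequence of policies, $P_T=\sum_{t=1}^T\|M_t^*-M_{t-1}^*\|_F$, and $\mathcal E_{T,W}=\sum_{t=1}^T\|M_{t,W}^{*(1)}-M_{t,RH}^*\|_F$. Then: (1) The dynamic policy regret satisfies $$\mathbb E\left[\sum_{t=1}^Tc_t(x_t,u_t)-\sum_{t=1}^Tc_t(x_t^{\pi_t},u_t^{\pi_t})\right]\le\widetilde{\mathcal O}(1+P_T+\mathcal E_{T,W}).$$ (2) If moreover the first-block finite-window error satisfies the uniform exponential decay of sensitivity bound $\|M_{t,W}^{*(1)}-M_{t,RH}^*\|_F\le C_{\mathrm{EDS}}\,\xi^W$ (for all $t$) for constants $C_{\mathrm{EDS}}>0$ and $\xi\in(0,1)$, and if $c_W$ further satisfies $c_W\ge\frac1{|\log\xi|}$, then $$\mathbb E\left[\sum_{t=1}^Tc_t(x_t,u_t)-\sum_{t=1}^Tc_t(x_t^{\pi_t},u_t^{\pi_t})\right]\le\widetilde{\mathcal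 O}(1+P_T).$$ Here $\widetilde{\mathcal O}(\cdot)$ hides logarithmic factors of $T$.
   Context: SYSTEM. $x_{t+1}=Ax_t+Bu_t+w_t$ with $x_t,w_t\in\mathbb R^{d_x}$, $u_t\in\mathbb R^{d_u}$, $d=\max\{d_x,d_u\}$, $A,B$ known, $x_0=0$, and $w_i=0$ for $i<0$. Stage costs are $c_t:\mathbb R^{d_x}\times\mathbb R^{d_u}\to\mathbb R$. $\|\cdot\|$ is the Euclidean norm of vectors and the spectral norm of matrices; $\|\cdot\|_F$ is the Frobenius norm, and for a tuple of matrices $\|\cdot\|_F^2$ is the sum of the squared Frobenius norms of the blocks. DAC POLICIES. Given a fixed matrix $K$, a memory length $H>1$ and a parameter $M=(M^{[0]},\dots,M^{[H-1]})$ with $M^{[i]}\in\mathbb R^{d_u\times d_x}$, the policy $\pi(K,M)$ plays $u_t=-Kx_t+\sum_{i=1}^H M^{[i-1]}w_{t-i}$. If parameter $M_s$ is used at each time $s$, the resulting state and action are denoted $x_t^K(M_{0:t-1})$ and $u_t^K(M_{0:t})$. For a comparator sequence $M_0^*,M_1^*,\dots,M_T^*$ with $\pi_t=\pi(K,M_t^* )$, $x_t^{\pi_t}=x_t^K(M^*_{0:t-1})$ and $u_t^{\pi_t}=u_t^K(M^*_{0:t})$. ASSUMPTIONS. (i) $\|A\|\le\kappa_A$, $\|B\|\le\kappa_B$; the disturbances $w_t$ ($t\ge 0$) are i.i.d. with $\mathbb E[w_t]=0$, $\mathbb E[w_tw_t^\top]\succeq\sigma^2 I$, $\|w_t\|\le\bar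 w$. (ii) Each $c_t$ is $\alpha$-strongly convex and $l$-smooth, and whenever $\|x\|,\|u\|\le D$ one has $\|\nabla_xc_t(x,u)\|,\|\nabla_uc_t(x,u)\|\le GD$. (iii) $K$ is $(\kappa,\gamma)$-strongly stable, $\kappa\ge1$, $\gamma\in(0,1)$: $A-BK=Q\Lambda Q^{-1}$ with $\Lambda$ complex diagonal, $Q$ complex non-singular, $\|\Lambda\|\le1-\gamma$, $\|K\|\le\kappa$, $\|Q\|,\|Q^{-1}\|\le\kappa$. DAC parameters lie in $\mathcal M=\{M=(M^{[0]},\dots,M^{[H-1]}):\|M^{[i-1]}\|\le\kappa^3\kappa_B(1-\gamma)^i,\ i=1,\dots,H\}$. TRUNCATED AND SURROGATE LOSSES. Let $\widetilde A_K=A-BK$ and $$\Psi_{t,i}^{K,h}(M_{t-h:t})=\widetilde A_K^i\mathbf 1_{i\le h}+\sum_{j=0}^h\widetilde A_K^jBM_{t-j}^{[i-j-1]}\mathbf 1_{1\le i-j\le H}.$$ For $t>H$, $f_t(M_{t-1-H:t})=\mathbb E[c_t(y_t^K(M_{t-1-H:t-1}),v_t^K(M_{t-1-H:t}))]$, where $y_{t+1}^K(M_{t-H:t})=\sum_{i=0}^{2H}\Psi_{t,i}^{K,H}(M_{t-H:t})w_{t-i}$ and $v_{t+1}^K(M_{t-H:t+1})=-Ky_{t+1}^K(M_{t-H:t})+\sum_{i=1}^HM_{t+1}^{[i-1]}w_{t+1-i}$. For $t\le H$, $f_t(M_{0:t})=\mathbb E[c_t(y_t^K(M_{0:t-1}),v_t^K(M_{0:t}))]$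 with $y_{t+1}^K(M_{0:t})=\sum_{i=0}^{2t}\Psi_{t,i}^{K,t}(M_{0:t})w_{t-i}$ and $v_{t+1}^K(M_{0:t+1})=-Ky_{t+1}^K(M_{0:t})+\sum_{i=1}^tM_{t+1}^{[i-1]}w_{t+1-i}$. The surrogate loss is $\tilde f_t(M)=f_t(M,\dots,M)$, $M\in\mathcal M$. CONSTANTS (properties recalled by the paper from the literature, or established there, under (i)-(iii), and taken as given). $D=\frac{\bar w\kappa^3(1+H\kappa_B^2\kappa^3)}{\gamma(1-\kappa^2(1-\gamma)^{H+1})}+\frac{\kappa_B\kappa^3\bar w}{\gamma}$. $L_f\le3\sqrt H\,GD\bar w\kappa_B\kappa^3$ is such that changing one argument of $f_t$ from $M$ to $\tilde M$ changes $f_t$ by at most $L_f\|M-\tilde M\|_F$. $G_f=3Hd^2G\bar w\kappa_B\kappa^3\gamma^{-1}$, with $\|\nabla\tilde f_t\|_F\le G_f$ on $\mathcal M$. Each $\tilde f_t$ is $\mu$-strongly convex on $\mathcal M$ with $\mu=\frac{\alpha\sigma^2\gamma^2}{36\kappa^{10}}$, and $L$-smooth on $\mathcal M$, where $L\le l\,\|\Sigma_w\|\big[(\kappa^2\kappa_B/\gamma)^2+(1+\kappa^3\kappa_B/\gamma)^2\big]$ with $\Sigma_w=\mathbb E[w_tw_t^\top]$. $D_M=\sup_{M,N\in\mathcal M}\|M-N\|_F$. Truncation: for any parameters in $\mathcal M$, $|\sum_{t=1}^Tf_t(M_{t-H-1:t})-\sum_{t=1}^Tc_t(x_t^K(M_{0:t-1}),u_t^K(M_{0:t}))|\le2TGD^2\kappa^3(1-\gamma)^{H+1}$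 (in expectation over the disturbances). GLOBAL REGULARIZED OBJECTIVE. For $\mathbf M=(M_1,\dots,M_T)\in\mathcal M^T$ and the fixed initial point $M_0\in\mathcal M$, $g_T^{RH}(\mathbf M)=\sum_{t=1}^T\tilde f_t(M_t)+\lambda\sum_{t=1}^T\|M_t-M_{t-1}\|_F$. $\mathbf M_{RH}^*=(M_{1,RH}^*,\dots,M_{T,RH}^* )$ is its minimizer over $\mathcal M^T$. Conventions: $M_{0,RH}^*=M_0^*=M_0$. POC ALGORITHM. Fix $M_0\in\mathcal M$; $\Pi_{\mathcal M}$ is the Frobenius-norm projection onto $\mathcal M$. OGD sequence: $M_1(0)=M_0$, $M_{s+1}(0)=\Pi_{\mathcal M}[M_s(0)-\delta\nabla\tilde f_s(M_s(0))]$ for $s\ge1$ (at time $t$ the predictions $\tilde f_1,\dots,\tilde f_{t+W-1}$ are exactly available, so that $M_{t+W}(0)$ is computed at time $t$). At each $t=1,\dots,T$, with the previously executed $M_{t-1}$ and $M_{t+W}(0)$ held fixed, for $\mathbf Z=(Z_t,\dots,Z_{t+W-1})\in\mathcal M^W$ let $F_t(\mathbf Z)=\sum_{s=t}^{t+W-1}\tilde f_s(Z_s)$ and $R_t(\mathbf Z)=\lambda\sum_{s=t}^{t+W-1}\|Z_s-Z_{s-1}\|_F+\lambda\|M_{t+W}(0)-Z_{t+W-1}\|_F$ with $Z_{t-1}:=M_{t-1}$. Start from $\mathbf M_{t,W}(0)=(M_t(0),\dots,M_{t+W-1}(0))$ and for $k=1,\dots,W$ set $$\mathbf M_{t,W}(k)=\arg\min_{\mathbf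 Z\in\mathcal M^W}\Big\{R_t(\mathbf Z)+\tfrac1{2\eta}\|\mathbf Z-(\mathbf M_{t,W}(k-1)-\eta\nabla F_t(\mathbf M_{t,W}(k-1)))\|_F^2\Big\}.$$ The executed parameter $M_t$ is the first block of $\mathbf M_{t,W}(W)$, and $u_t=-Kx_t+\sum_{i=1}^HM_t^{[i-1]}w_{t-i}$; then $w_t=x_{t+1}-Ax_t-Bu_t$ is recovered. The costs $c_s$ (hence $\tilde f_s$) are defined and satisfy the assumptions for all indices $s\le T+W-1$ used. LOCAL MINIMIZER. $\mathbf M_{t,W}^*$ is the unique minimizer of $g_{t,W}^{RH}=F_t+R_t$ over $\mathcal M^W$, and $M_{t,W}^{*(1)}$ is its first block. Besides logarithmic factors of $T$, $\widetilde{\mathcal O}(\cdot)$ hides factors depending only on the fixed problem constants ($\kappa_A,\kappa_B,\kappa,\gamma,\bar w,\sigma,\alpha,l,G,d_x,d_u,\eta,c_H,c_W$, and in (2) $C_{\mathrm{EDS}},\xi$). *)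

(* Defs.v *)
From HB Require Import structures.
From mathcomp Require Import all_boot all_order all_algebra.
From mathcomp Require Import all_classical all_reals all_analysis.
From mathcomp.real_closed Require Import complex.

Set Implicit Arguments.
Unset Strict Implicit.
Unset Printing Implicit Defensive.

Import Order.TTheory GRing.Theory Num.Theory.
Import numFieldNormedType.Exports.

Local Open Scope classical_set_scope.
Local Open Scope ring_scope.

(* Frobenius norm; on 'cV[R]_n this is the Euclidean norm, and on a block
   column it is the square root of the sum of the squared norms of the blocks.
   (The library norm `|A| on matrices is the max norm, whence this one.) *)
Definition fnorm (R : realType) m n (A : 'M[R]_(m, n)) : R :=
  Num.sqrt (\sum_i \sum_j A i j ^+ 2).

Definition opnorm (R : realType) m n (A : 'M[R]_(m, n)) : R :=
  sup [set fnorm (A *m v) | v in [set v : 'cV[R]_n | fnorm v <= 1]].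

Definition fnormC (R : realType) m n (A : 'M[R[i]]_(m, n)) : R :=
  Num.sqrt (\sum_i \sum_j ComplexField.Normc.normc (A i j) ^+ 2).

Definition opnormC (R : realType) m n (A : 'M[R[i]]_(m, n)) : R :=
  sup [set fnormC (A *m v)
      | v in [set v : 'cV[R[i]]_n | fnormC v <= 1]].

Definition psd_le (R : realType) n (A B : 'M[R]_n) : Prop :=
  forall v : 'cV[R]_n, 0 <= (v^T *m (B - A) *m v) ord0 ord0.

(* Represents 'd f X for the Frobenius inner product as soon as f is
   differentiable at X. *)
Definition gradient (R : realType) m n (f : 'M[R]_(m, n) -> R)
    (X : 'M[R]_(m, n)) : 'M[R]_(m, n) :=
  \matrix_(i, j) 'D_(delta_mx i j) f X.

Definition smooth_on (R : realType) m n (S : set 'M[R]_(m, n)) (L : R)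
    (f : 'M[R]_(m, n) -> R) : Prop :=
  (forall X, S X -> differentiable f X) /\
  (forall X Y, S X -> S Y ->
     fnorm (gradient f X - gradient f Y) <= L * fnorm (X - Y)).

Definition strongly_convex_on (R : realType) m n (S : set 'M[R]_(m, n))
    (a : R) (f : 'M[R]_(m, n) -> R) : Prop :=
  forall X Y s, S X -> S Y -> 0 <= s <= 1 ->
    f (s *: X + (1 - s) *: Y) <=
    s * f X + (1 - s) * f Y - a / 2 * s * (1 - s) * fnorm (X - Y) ^+ 2.

Definition is_argmin (R : realType) (T : Type) (S : set T) (g : T -> R)
    (z : T) : Prop :=
  S z /\ forall z', S z' -> g z <= g z'.

(* [k] matrices of size (p, n) stacked vertically.  A parameter
   (M^[0], ..., M^[H-1]) is a [blocks H du dx], a window of W of them is a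
   [blocks W _ _] of such parameters. *)
Notation blocks R k p n := 'M[R]_(\sum_(i < k) p, n).

(* The j-th block, 0 when j is out of range. *)
Definition blk (R : realType) (k p n : nat) (M : blocks R k p n) (j : nat) :
    'M[R]_(p, n) :=
  if insub j is Some i then @submxcol R k (fun=> p) n M i else 0.

Section random_vectors.
Context (R : realType) (d : measure_display) (Omega : measurableType d).
Context (P : probability Omega R) (n : nat).

(* Events {X \in D}, D a Borel set of R^n (product sigma-algebra on tuples). *)
Definition vec_event (X : Omega -> 'cV[R]_n) (D : set (n.-tuple R)) :
    set Omega :=
  [set omega | D [tuple X omega i ord0 | i < n]].

Definition vec_measurable (X : Omega -> 'cV[R]_n) : Prop :=
  forall i, measurable_fun [set: Omega] (fun omega => X omega i ord0).

Definition mutually_independent (w : nat -> Omega -> 'cV[R]_n) : Prop :=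
  forall (J : seq nat) (D : nat -> set (n.-tuple R)),
    uniq J -> (forall j, measurable (D j)) ->
    (P (\bigcap_(j in [set` J]) vec_event (w j) (D j)) =
     \prod_(j <- J) P (vec_event (w j) (D j)))%E.

Definition identically_distributed (w : nat -> Omega -> 'cV[R]_n) : Prop :=
  forall (s t : nat) (D : set (n.-tuple R)), measurable D ->
    P (vec_event (w s) D) = P (vec_event (w t) D).

Definition second_moment (X : Omega -> 'cV[R]_n) : 'M[R]_n :=
  \matrix_(i, j) fine 'E_P[fun omega => X omega i ord0 * X omega j ord0].

End random_vectors.

Record constants (R : realType) := Constants {
  kA : R; kB : R; kappa : R; gamma : R; wbar : R; sigma : R;
  alpha : R; ell : R; cG : R; eta : R; cH : R; cW : R }.

Record problem (R : realType) (dx du : nat) := Problem {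
  disp : measure_display;
  Omega : measurableType disp;
  Pr : probability Omega R;
  sysA : 'M[R]_dx;
  sysB : 'M[R]_(dx, du);
  gainK : 'M[R]_(du, dx);
  noise : nat -> Omega -> 'cV[R]_dx;
  cost : nat -> 'cV[R]_dx -> 'cV[R]_du -> R }.

Arguments noise {R dx du} p _ _.

Section constants_defs.
Context (R : realType) (k : constants R).

Definition mu : R :=
  alpha k * sigma k ^+ 2 * gamma k ^+ 2 / (36 * kappa k ^+ 10).

Definition rho : R := Num.sqrt (1 - mu * eta k).

Definition radiusD (H : nat) : R :=
  wbar k * kappa k ^+ 3 * (1 + H%:R * kB k ^+ 2 * kappa k ^+ 3) /
    (gamma k * (1 - kappa k ^+ 2 * (1 - gamma k) ^+ H.+1))
  + kB k * kappa k ^+ 3 * wbar k / gamma k.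

Definition horizon (a : R) (T : nat) : nat := `|Num.ceil (a * ln T%:R)|%N.

End constants_defs.

Section control.
Context (R : realType) (dx du : nat) (k : constants R) (S : problem R dx du).
Context (H : nat).

Local Notation dac := (blocks R H du dx).

Definition AK : 'M[R]_dx := sysA S - sysB S *m gainK S.

(* w_{t-i}, with w_s = 0 for s < 0 *)
Definition wlag (t i : nat) (omega : Omega S) : 'cV[R]_dx :=
  if (i <= t)%N then noise S (t - i)%N omega else 0.

(* In [dac_input], [state] and [action], [N s] is the parameter used at time s;
   the block M^[i-1] is [blk M i.-1]. *)
Definition dac_input (N : nat -> dac) (t : nat) (x : 'cV[R]_dx)
    (omega : Omega S) : 'cV[R]_du :=
  - (gainK S *m x) + \sum_(1 <= i < H.+1) blk (N t) i.-1 *m wlag t i omega.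

Fixpoint state (N : nat -> dac) (t : nat) (omega : Omega S) : 'cV[R]_dx :=
  if t is t'.+1 then
    sysA S *m state N t' omega
    + sysB S *m dac_input N t' (state N t' omega) omega + noise S t' omega
  else 0.

Definition action (N : nat -> dac) (t : nat) (omega : Omega S) : 'cV[R]_du :=
  dac_input N t (state N t omega) omega.

(* Psi_{t,i}^{K,h}(N_{t-h}, ..., N_t).  The natural subtraction i - j is 0 when
   i <= j, so the test below is 1 <= i - j <= H over the integers; t - j is
   never truncated, as [Psi] is used with h <= t. *)
Definition Psi (h : nat) (N : nat -> dac) (t i : nat) : 'M[R]_dx :=
  (if (i <= h)%N then AK ^+ i else 0)
  + \sum_(0 <= j < h.+1)
      (if (1 <= i - j <= H)%N
       then AK ^+ j *m sysB S *m blk (N (t - j)%N) (i - j).-1 else 0).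

(* Memory of the losses at time t >= 1: the superscript of Psi in y_t, and
   also the number of noise terms entering v_t. *)
Definition memory (t : nat) : nat := if (H < t)%N then H else t.-1.

Definition ytrunc (N : nat -> dac) (t : nat) (omega : Omega S) : 'cV[R]_dx :=
  \sum_(0 <= i < (2 * memory t).+1)
    Psi (memory t) N t.-1 i *m wlag t.-1 i omega.

Definition vtrunc (N : nat -> dac) (t : nat) (omega : Omega S) : 'cV[R]_du :=
  - (gainK S *m ytrunc N t omega)
  + \sum_(1 <= i < (memory t).+1) blk (N t) i.-1 *m wlag t i omega.

(* f_t.  Only the entries N_{t-1-H}, ..., N_t (N_0, ..., N_t if t <= H) of the
   sequence N matter. *)
Definition loss (t : nat) (N : nat -> dac) : R :=
  fine 'E_(Pr S)[fun omega => cost S t (ytrunc N t omega) (vtrunc N t omega)].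

Definition surrogate (t : nat) (M : dac) : R := loss t (fun=> M).

Definition dac_set : set dac :=
  [set M | forall i, (1 <= i <= H)%N ->
     opnorm (blk M i.-1) <= kappa k ^+ 3 * kB k * (1 - gamma k) ^+ i].

Definition disturbance_assumption : Prop :=
  [/\ opnorm (sysA S) <= kA k, opnorm (sysB S) <= kB k &
   [/\ forall t, vec_measurable (noise S t),
       mutually_independent (Pr S) (noise S),
       identically_distributed (Pr S) (noise S),
       forall t i, ('E_(Pr S)[fun omega => noise S t omega i ord0] = 0)%E &
       (forall t, psd_le (sigma k ^+ 2)%:M (second_moment (Pr S) (noise S t))) /\
       (forall t omega, fnorm (noise S t omega) <= wbar k)]].

Definition joint_cost (t : nat) (z : 'cV[R]_(dx + du)) : R :=
  cost S t (usubmx z) (dsubmx z).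

Definition cost_assumption (t : nat) : Prop :=
  [/\ strongly_convex_on setT (alpha k) (joint_cost t),
      smooth_on setT (ell k) (joint_cost t) &
      forall x u, fnorm x <= radiusD k H -> fnorm u <= radiusD k H ->
        fnorm (gradient (fun x' => cost S t x' u) x) <= cG k * radiusD k H /\
        fnorm (gradient (fun u' => cost S t x u') u) <= cG k * radiusD k H].

Definition strongly_stable : Prop :=
  exists (Q Lam : 'M[R[i]]_dx),
    [/\ Q \in unitmx, is_diag_mx Lam,
        map_mx (real_complex R) AK = Q *m Lam *m invmx Q,
        opnormC Lam <= 1 - gamma k &
        [/\ opnorm (gainK S) <= kappa k, opnormC Q <= kappa k &
            opnormC (invmx Q) <= kappa k]].

Definition coord_lipschitz (Lf : R) (t : nat) : Prop :=
  forall (N N' : nat -> dac) (j : nat),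
    (forall s, dac_set (N s)) -> (forall s, dac_set (N' s)) ->
    (forall s, s != j -> N s = N' s) ->
    `|loss t N - loss t N'| <= Lf * fnorm (N j - N' j).

Definition Lf_bound : R :=
  3 * Num.sqrt H%:R * cG k * radiusD k H * wbar k * kB k * kappa k ^+ 3.

Definition L_bound : R :=
  ell k * opnorm (second_moment (Pr S) (noise S 0%N)) *
  ((kappa k ^+ 2 * kB k / gamma k) ^+ 2
   + (1 + kappa k ^+ 3 * kB k / gamma k) ^+ 2).

Definition path_length (N : nat -> dac) (T : nat) : R :=
  \sum_(1 <= t < T.+1) fnorm (N t - N t.-1).

(* Elements (M_1, ..., M_T) of the T-fold power of [dac_set] are represented
   by sequences with entry 0 fixed to the initial point. *)
Definition admissible (M0 : dac) (T : nat) : set (nat -> dac) :=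
  [set N | N 0%N = M0 /\ forall t, (1 <= t <= T)%N -> dac_set (N t)].

Definition gRH (lambda : R) (T : nat) (N : nat -> dac) : R :=
  \sum_(1 <= t < T.+1) surrogate t (N t) + lambda * path_length N T.

Definition is_ogd (delta : R) (M0 : dac) (n : nat) (ogd : nat -> dac) : Prop :=
  ogd 1%N = M0 /\
  forall s, (1 <= s <= n)%N ->
    is_argmin dac_set
      (fun Z => fnorm (Z - (ogd s - delta *: gradient (surrogate s) (ogd s))))
      (ogd s.+1).

Section window.
Context (W : nat).

Local Notation window := (blocks R W (\sum_(i < H) du) dx).

(* Block j of Z is Z_{t+j}, j = 0, ..., W-1. *)
Definition window_set : set window :=
  [set Z | forall j, (j < W)%N -> dac_set (blk Z j)].

Definition Fwin (t : nat) (Z : window) : R :=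
  \sum_(0 <= j < W) surrogate (t + j) (blk Z j).

(* Z_{t+j-1}, with Z_{t-1} = prev *)
Definition wprev (prev : dac) (Z : window) (j : nat) : dac :=
  if j is j'.+1 then blk Z j' else prev.

Definition Rwin (lambda : R) (prev next : dac) (Z : window) : R :=
  lambda * (\sum_(0 <= j < W) fnorm (blk Z j - wprev prev Z j))
  + lambda * fnorm (next - wprev prev Z W).

Definition prox_objective (lambda : R) (t : nat) (prev next : dac)
    (Y Z : window) : R :=
  Rwin lambda prev next Z
  + (2 * eta k)^-1 * fnorm (Z - (Y - eta k *: gradient (Fwin t) Y)) ^+ 2.

Definition is_poc (lambda delta : R) (M0 : dac) (T : nat)
    (ogd N : nat -> dac) : Prop :=
  [/\ is_ogd delta M0 (T + W).-1 ogd, N 0%N = M0 &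
      forall t, (1 <= t <= T)%N ->
        exists Z : nat -> window,
          [/\ forall j, (j < W)%N -> blk (Z 0%N) j = ogd (t + j)%N,
              forall i, (1 <= i <= W)%N ->
                is_argmin window_set
                  (prox_objective lambda t (N t.-1) (ogd (t + W)%N) (Z i.-1))
                  (Z i) &
              N t = blk (Z W) 0]].

Definition is_local_minimizer (lambda : R) (t : nat) (prev next : dac)
    (Z : window) : Prop :=
  is_argmin window_set (fun Z' => Fwin t Z' + Rwin lambda prev next Z') Z.

End window.

Definition expected_regret (T : nat) (N Nstar : nat -> dac) : \bar R :=
  ('E_(Pr S)[fun omega =>
    (\sum_(1 <= t < T.+1) cost S t (state N t omega) (action N t omega)
     - \sum_(1 <= t < T.+1)
         cost S t (state Nstar t omega) (action Nstar t omega))%R])%E.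

End control.

(* If rho = 0 (not possible together with the other assumptions, unless the
   parameter set is trivial) the last bound reads 0 <= cW since ln 0 = 0. *)
Record admissible_constants (R : realType) (k : constants R) : Prop := {
  ac_alpha : 0 < alpha k;
  ac_sigma : 0 < sigma k;
  ac_kappa : 1 <= kappa k;
  ac_gamma : 0 < gamma k < 1;
  ac_eta : 0 < eta k;
  ac_cH : 1 / `|ln (1 - gamma k)| <= cH k;
  ac_cW : 1 / `|ln (rho k)| <= cW k }.

(* [Lf], [smoothL]: the constants L_f, L;  [init_par], [ogd], [executed]: M_0, M_s(0),
   M_t;  [comparator]: the comparators M_t^*;  [minRH], [minloc]: M_{t,RH}^* and the
   whole window M_{t,W}^*. *)
Record run (R : realType) (dx du H W : nat) := Run {
  Lf : R;
  smoothL : R;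
  init_par : blocks R H du dx;
  ogd : nat -> blocks R H du dx;
  executed : nat -> blocks R H du dx;
  comparator : nat -> blocks R H du dx;
  minRH : nat -> blocks R H du dx;
  minloc : nat -> blocks R W (\sum_(i < H) du) dx }.

Definition lambda R dx du H W (r : @run R dx du H W) : R :=
  H.+2%:R ^+ 2 * Lf r.

Record poc_setting (R : realType) (dx du : nat) (k : constants R)
    (T H W : nat) (S : problem R dx du) (r : run R dx du H W) : Prop := {
  ps_H : (1 < H)%N;
  ps_noise : disturbance_assumption k S;
  ps_cost : forall t, (1 <= t <= (T + W).-1)%N -> cost_assumption k S H t;
  ps_stable : strongly_stable k S;
  ps_Lf_le : Lf r <= Lf_bound k H;
  ps_Lf : forall t, (1 <= t <= (T + W).-1)%N ->
    coord_lipschitz k S H (Lf r) t;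
  ps_L_le : smoothL r <= L_bound k S;
  ps_L : forall t, (1 <= t <= (T + W).-1)%N ->
    smooth_on (@dac_set R dx du k H) (smoothL r) (surrogate S t (H := H));
  ps_eta : eta k <= 1 / smoothL r;
  ps_init : dac_set k (init_par r);
  ps_poc :
    is_poc k S W (lambda r) (1 / smoothL r) (init_par r) T (ogd r) (executed r);
  ps_comp : admissible k (init_par r) T (comparator r);
  ps_minRH : is_argmin (admissible k (init_par r) T) (gRH S (lambda r) T) (minRH r);
  ps_minloc : forall t, (1 <= t <= T)%N ->
    is_local_minimizer k S (lambda r) t (executed r t.-1) (ogd r (t + W)%N)
      (minloc r t) }.

Definition window_error R dx du H W (r : @run R dx du H W) (t : nat) : R :=
  fnorm (blk (minloc r t) 0 - minRH r t).

(* Main.v *)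
Require Import Defs.
From mathcomp Require Import all_boot all_order all_algebra.
From mathcomp Require Import all_classical all_reals all_analysis.
From mathcomp.real_closed Require Import complex.
From mathcomp Require Import measurable_realfun ring lra zify.

Set Implicit Arguments.
Unset Strict Implicit.
Unset Printing Implicit Defensive.

Import Order.TTheory GRing.Theory Num.Theory.
Import numFieldNormedType.Exports.

Local Open Scope classical_set_scope.
Local Open Scope ring_scope.

(** Why the theorem holds.  The regret is measured through the regularized
    objective g.  As H >= log T / |log (1 - gamma)|, replacing the true trajectory
    by the truncated one costs a power of log T over all rounds
    ([total_truncation]).  Replacing the H+2 most recent parameters in f_t by
    copies of the last one costs at most lambda times the path length
    ([total_loss_surrogate]); for the executed sequence this term is the
    regularizer of g, and for the comparator it gives 2 lambda P_T.  Since the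
    comparator is a competitor in the minimization of g, what is left is the
    difference of the values of g at the executed sequence and at its minimizer,
    which is Lipschitz in the sum of the distances |M_t - M_{t,RH}|
    ([gRH_lipschitz]).  Each distance is split at the first block of the local
    minimizer: one part is the window error, the other is the optimization error
    of W proximal gradient steps.  Such a step contracts squared distances to the
    local minimizer by 1 - mu eta ([prox_contraction]), so W steps leave a factor
    rho^W <= 1/T ([window_iterates], [tracking_error]).

    The contraction needs the strong convexity of the surrogate losses.  In the
    truncated dynamics, v + K y is the sum of the M^[i-1] w_{t-i}; by
    independence its energy is at least sigma^2 |M|^2 ([noise_energy]), while it
    is at most (1 + kappa^2) times the energy of (y, v).  Hence the modulus
    alpha sigma^2 / (1 + kappa^2), which exceeds mu
    ([surrogate_strongly_convex], [mu_lt_modulus]).  This requires t > H: earlier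
    losses do not see all the blocks of M, and the first one is even constant.
    The first H rounds are therefore charged the diameter of the parameter set,
    and they are only logarithmically many.

    Two degenerate situations are separated.  If the parameter set is a single
    point, the executed and the comparator trajectories coincide and the regret
    is 0 ([regret_trivial]).  Otherwise the modulus is at most the smoothness
    constant, which forces mu eta < 1 ([mu_eta_lt1]), whence 0 < rho < 1 and
    W >= 1.

    In the resulting bound ([regret_bound]) every factor is at most a fixed power
    of C0 log T, where C0 dominates all the constants of the problem
    ([regret_polylog]).  Under exponential decay of sensitivity the window errors
    sum to at most T C_EDS xi^W <= C_EDS, which gives the second part. *)

(** * Frobenius inner product and operator norm *)

Section frobenius.
Context (R : realType).

Definition mdot m n (A B : 'M[R]_(m, n)) : R := \sum_i \sum_j A i j * B i j.

Lemma mdotC m n (A B : 'M[R]_(m, n)) : mdot A B = mdot B A.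
Proof. by apply: eq_bigr => i _; apply: eq_bigr => j _; rewrite mulrC. Qed.

Lemma mdotDl m n (A B C : 'M[R]_(m, n)) : mdot (A + B) C = mdot A C + mdot B C.
Proof.
rewrite /mdot -big_split; apply: eq_bigr => i _ /=; rewrite -big_split.
by apply: eq_bigr => j _ /=; rewrite mxE mulrDl.
Qed.

Lemma mdotZl m n a (A B : 'M[R]_(m, n)) : mdot (a *: A) B = a * mdot A B.
Proof.
rewrite /mdot mulr_sumr; apply: eq_bigr => i _; rewrite mulr_sumr.
by apply: eq_bigr => j _ /=; rewrite mxE mulrA.
Qed.

Lemma mdotDr m n (A B C : 'M[R]_(m, n)) : mdot A (B + C) = mdot A B + mdot A C.
Proof. by rewrite mdotC mdotDl !(mdotC A). Qed.

Lemma mdotZr m n a (A B : 'M[R]_(m, n)) : mdot A (a *: B) = a * mdot A B.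
Proof. by rewrite mdotC mdotZl mdotC. Qed.

Lemma mdotNl m n (A B : 'M[R]_(m, n)) : mdot (- A) B = - mdot A B.
Proof. by rewrite -scaleN1r mdotZl mulN1r. Qed.

Lemma mdotNr m n (A B : 'M[R]_(m, n)) : mdot A (- B) = - mdot A B.
Proof. by rewrite mdotC mdotNl mdotC. Qed.

Lemma mdot0r m n (A : 'M[R]_(m, n)) : mdot A 0 = 0.
Proof. by rewrite -(scale0r 0) mdotZr mul0r. Qed.

Definition mdotE := (mdotDl, mdotDr, mdotNl, mdotNr, mdotZl, mdotZr).

Lemma mdot_ge0 m n (A : 'M[R]_(m, n)) : 0 <= mdot A A.
Proof. by apply: sumr_ge0 => i _; apply: sumr_ge0 => j _; rewrite -expr2 sqr_ge0. Qed.

Lemma fnormE m n (A : 'M[R]_(m, n)) : fnorm A = Num.sqrt (mdot A A).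
Proof. by congr Num.sqrt; apply: eq_bigr => i _; apply: eq_bigr => j _; rewrite expr2. Qed.

Lemma fnorm_ge0 m n (A : 'M[R]_(m, n)) : 0 <= fnorm A.
Proof. exact: sqrtr_ge0. Qed.

Lemma fnorm_sqr m n (A : 'M[R]_(m, n)) : fnorm A ^+ 2 = mdot A A.
Proof. by rewrite fnormE sqr_sqrtr ?mdot_ge0. Qed.

Lemma fnormZ m n a (A : 'M[R]_(m, n)) : fnorm (a *: A) = `|a| * fnorm A.
Proof.
rewrite !fnormE mdotZl mdotZr mulrA -expr2 sqrtrM ?sqr_ge0 //.
by rewrite sqrtr_sqr.
Qed.

Lemma fnormN m n (A : 'M[R]_(m, n)) : fnorm (- A) = fnorm A.
Proof. by rewrite -scaleN1r fnormZ normrN1 mul1r. Qed.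

Lemma fnorm0 m n : fnorm (0 : 'M[R]_(m, n)) = 0.
Proof. by rewrite -(scale0r 0) fnormZ normr0 mul0r. Qed.

Lemma fnormBC m n (A B : 'M[R]_(m, n)) : fnorm (A - B) = fnorm (B - A).
Proof. by rewrite -fnormN opprB. Qed.

Lemma fnorm_entry m n (A : 'M[R]_(m, n)) i j : `|A i j| <= fnorm A.
Proof.
rewrite -(@ler_pXn2r _ 2) ?nnegrE ?fnorm_ge0 // fnorm_sqr real_normK ?num_real //.
rewrite /mdot (bigD1 i) //= (bigD1 j) //= -expr2 -addrA lerDl addr_ge0 //.
  by apply: sumr_ge0 => k _; rewrite -expr2 sqr_ge0.
by apply: sumr_ge0 => k _; apply: sumr_ge0 => l _; rewrite -expr2 sqr_ge0.
Qed.

Lemma fnorm_eq0 m n (A : 'M[R]_(m, n)) : (fnorm A == 0) = (A == 0).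
Proof.
apply/eqP/eqP => [A0|->]; last exact: fnorm0.
apply/matrixP => i j; rewrite mxE; apply/eqP; rewrite -normr_le0 -A0.
exact: fnorm_entry.
Qed.

Lemma cauchy_schwarz m n (A B : 'M[R]_(m, n)) : mdot A B <= fnorm A * fnorm B.
Proof.
have [->|B0] := eqVneq B 0.
  by rewrite fnorm0 mulr0 -(scale0r 0) mdotZr mul0r.
have nB : 0 < fnorm B by rewrite lt_neqAle fnorm_ge0 eq_sym fnorm_eq0 B0.
have [->|A0] := eqVneq A 0.
  by rewrite fnorm0 mul0r -(scale0r 0) mdotZl mul0r.
have nA : 0 < fnorm A by rewrite lt_neqAle fnorm_ge0 eq_sym fnorm_eq0 A0.
have := mdot_ge0 (fnorm B *: A - fnorm A *: B).
rewrite !mdotE (mdotC B A) -!fnorm_sqr => h.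
have : 0 <= (fnorm A * fnorm B) * (fnorm A * fnorm B - mdot A B) by nra.
by rewrite pmulr_rge0 ?mulr_gt0 // subr_ge0.
Qed.

Lemma fnormD m n (A B : 'M[R]_(m, n)) : fnorm (A + B) <= fnorm A + fnorm B.
Proof.
rewrite -(@ler_pXn2r _ 2) ?nnegrE ?addr_ge0 ?fnorm_ge0 // fnorm_sqr.
rewrite !mdotE sqrrD !fnorm_sqr (mdotC B A).
by have := cauchy_schwarz A B; lra.
Qed.

Lemma fnormB m n (A B : 'M[R]_(m, n)) : fnorm (A - B) <= fnorm A + fnorm B.
Proof. by rewrite -(fnormN B); exact: fnormD. Qed.

Lemma fnorm_sum m n (I : Type) (s : seq I) (Q : pred I) (F : I -> 'M[R]_(m, n)) :
  fnorm (\sum_(i <- s | Q i) F i) <= \sum_(i <- s | Q i) fnorm (F i).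
Proof.
elim/big_rec2: _ => [|i x y _ le]; first by rewrite fnorm0.
by apply: le_trans (fnormD _ _) _; rewrite lerD2l.
Qed.

Lemma fnorm_triangle m n (A B C : 'M[R]_(m, n)) :
  fnorm (A - C) <= fnorm (A - B) + fnorm (B - C).
Proof. by rewrite -[A - C](subrKA B); exact: fnormD. Qed.

(** The Hilbert-space identity behind the strong convexity of a squared
    distance. *)
Lemma fnorm_conv_sqr m n (X Y Q : 'M[R]_(m, n)) s :
  fnorm (s *: X + (1 - s) *: Y - Q) ^+ 2 =
  s * fnorm (X - Q) ^+ 2 + (1 - s) * fnorm (Y - Q) ^+ 2
  - s * (1 - s) * fnorm (X - Y) ^+ 2.
Proof.
rewrite !fnorm_sqr !mdotE (mdotC Y X) (mdotC Q X) (mdotC Q Y); ring.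
Qed.

Lemma fnorm_colmx m1 m2 n (A : 'M[R]_(m1, n)) (B : 'M[R]_(m2, n)) :
  fnorm (col_mx A B) ^+ 2 = fnorm A ^+ 2 + fnorm B ^+ 2.
Proof.
rewrite !fnorm_sqr /mdot big_split_ord /=; congr (_ + _).
  by apply: eq_bigr => i _; apply: eq_bigr => j _; rewrite col_mxEu.
by apply: eq_bigr => i _; apply: eq_bigr => j _; rewrite col_mxEd.
Qed.

Lemma mdot_delta m n (A : 'M[R]_(m, n)) i j : mdot (delta_mx i j) A = A i j.
Proof.
rewrite /mdot (bigD1 i) //= (bigD1 j) //= mxE !eqxx mul1r big1 ?addr0; last first.
  by move=> l /negPf nl; rewrite mxE nl andbF mul0r.
rewrite big1 ?addr0 // => k /negPf nk; rewrite big1 // => l _.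
by rewrite mxE nk mul0r.
Qed.

(** Crude, but enough for the supremum defining the operator norm to be finite. *)
Lemma mulmx_entry_bound m n (A : 'M[R]_(m, n)) (v : 'cV[R]_n) :
  fnorm v <= 1 -> fnorm (A *m v) <= \sum_i \sum_j `|A i j|.
Proof.
move=> v1.
have -> : A *m v = \sum_i \sum_j (A i j * v j ord0) *: delta_mx i ord0.
  apply/colP => i; rewrite !mxE summxE (bigD1 i) //= [X in _ + X]big1 ?addr0.
    by rewrite summxE; apply: eq_bigr => j _; rewrite !mxE !eqxx mulr1.
  move=> l nl; rewrite summxE big1 // => j _.
  by rewrite !mxE eq_sym (negPf nl) mulr0.
apply: le_trans (fnorm_sum _ _ _) _; apply: ler_sum => i _.
apply: le_trans (fnorm_sum _ _ _) _; apply: ler_sum => j _.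
rewrite fnormZ fnormE mdot_delta mxE !eqxx sqrtr1 mulr1 normrM ler_piMr //.
exact: le_trans (fnorm_entry _ _ _) v1.
Qed.

Lemma opnorm_has_sup m n (A : 'M[R]_(m, n)) :
  has_sup [set fnorm (A *m v) | v in [set v : 'cV[R]_n | fnorm v <= 1]].
Proof.
split; first by exists (fnorm (A *m (0 : 'cV[R]_n))); exists 0 => //=; rewrite fnorm0.
exists (\sum_i \sum_j `|A i j|) => _ [v /= v1 <-].
exact: mulmx_entry_bound.
Qed.

Lemma opnorm_unit m n (A : 'M[R]_(m, n)) (v : 'cV[R]_n) :
  fnorm v <= 1 -> fnorm (A *m v) <= opnorm A.
Proof.
by move=> v1; apply: sup_upper_bound; [exact: opnorm_has_sup | exists v].
Qed.

Lemma opnorm_ge0 m n (A : 'M[R]_(m, n)) : 0 <= opnorm A.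
Proof.
by apply: le_trans (@opnorm_unit _ _ A 0 _); rewrite ?fnorm_ge0 ?fnorm0.
Qed.

Lemma opnormP m n (A : 'M[R]_(m, n)) (v : 'cV[R]_n) :
  fnorm (A *m v) <= opnorm A * fnorm v.
Proof.
have [->|v0] := eqVneq v 0; first by rewrite mulmx0 !fnorm0 mulr0.
have nv : 0 < fnorm v by rewrite lt_neqAle fnorm_ge0 eq_sym fnorm_eq0 v0.
have := @opnorm_unit _ _ A ((fnorm v)^-1 *: v).
rewrite -scalemxAr !fnormZ ger0_norm ?invr_ge0 ?fnorm_ge0 //.
rewrite mulVf ?gt_eqF // => /(_ (lexx _)).
by rewrite mulrC ler_pdivrMr.
Qed.

Lemma opnorm0 m n : opnorm (0 : 'M[R]_(m, n)) = 0.
Proof.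
apply/eqP; rewrite eq_le opnorm_ge0 andbT; apply: sup_le_ub.
  exact: (opnorm_has_sup 0).1.
by move=> _ [v _ <-]; rewrite mul0mx fnorm0.
Qed.

Lemma opnorm_conv m n (A B : 'M[R]_(m, n)) s c : 0 <= s <= 1 ->
  opnorm A <= c -> opnorm B <= c -> opnorm (s *: A + (1 - s) *: B) <= c.
Proof.
move=> /andP[s0 s1] Ac Bc; apply: sup_le_ub.
  exact: (opnorm_has_sup _).1.
move=> _ [v /= v1 <-]; rewrite mulmxDl -!scalemxAl.
apply: le_trans (fnormD _ _) _; rewrite !fnormZ !ger0_norm ?subr_ge0 //.
have hA := le_trans (opnorm_unit A v1) Ac.
have hB := le_trans (opnorm_unit B v1) Bc.
have := ler_wpM2l s0 hA; have : (1 - s) * fnorm (B *m v) <= (1 - s) * c.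
  by rewrite ler_wpM2l // subr_ge0.
lra.
Qed.

Lemma fnorm_le_opnorm m n (A : 'M[R]_(m, n)) :
  fnorm A ^+ 2 <= n%:R * opnorm A ^+ 2.
Proof.
have -> : fnorm A ^+ 2 = \sum_j fnorm (A *m delta_mx j (ord0 : 'I_1)) ^+ 2.
  rewrite fnorm_sqr /mdot exchange_big; apply: eq_bigr => j _.
  rewrite fnorm_sqr /mdot; apply: eq_bigr => i _.
  by rewrite big_ord1 -colE mxE.
apply: (@le_trans _ _ (\sum_(j < n) opnorm A ^+ 2)); last first.
  by rewrite sumr_const card_ord mulr_natl lexx.
apply: ler_sum => j _; rewrite ler_pXn2r ?nnegrE ?fnorm_ge0 ?opnorm_ge0 //.
apply: opnorm_unit; rewrite fnormE mdot_delta mxE !eqxx sqrtr1.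
exact: lexx.
Qed.

End frobenius.

(** * Block decomposition *)

Section blocks.
Context (R : realType) (k p n : nat).
Implicit Types (M N : blocks R k p n).

Lemma blkE M (j : 'I_k) : blk M j = @submxcol R k (fun=> p) n M j.
Proof. by rewrite /blk insubT //= => lj; congr submxcol; apply: val_inj. Qed.

Lemma blk_out M j : (k <= j)%N -> blk M j = 0.
Proof. by move=> kj; rewrite /blk insubF // ltnNge kj. Qed.

Lemma blkD M N j : blk (M + N) j = blk M j + blk N j.
Proof.
rewrite /blk; case: insub => [i|]; last by rewrite addr0.
by apply/matrixP => x y; rewrite !mxE.
Qed.

Lemma blkZ a M j : blk (a *: M) j = a *: blk M j.
Proof.
rewrite /blk; case: insub => [i|]; last by rewrite scaler0.
by apply/matrixP => x y; rewrite !mxE.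
Qed.

Lemma blk0 j : blk (0 : blocks R k p n) j = 0.
Proof. by rewrite /blk; case: insub => // i; apply/matrixP => x y; rewrite !mxE. Qed.

Lemma blkP a M N j : blk (a *: M + N) j = a *: blk M j + blk N j.
Proof. by rewrite blkD blkZ. Qed.

Lemma blkN M j : blk (- M) j = - blk M j.
Proof.
rewrite /blk; case: insub => [i|]; last by rewrite oppr0.
by apply/matrixP => x y; rewrite !mxE.
Qed.

Lemma blkB M N j : blk (M - N) j = blk M j - blk N j.
Proof. by rewrite blkD blkN. Qed.

Lemma mdot_blk M N : mdot M N = \sum_(0 <= j < k) mdot (blk M j) (blk N j).
Proof.
rewrite big_mkord /mdot; under [RHS]eq_bigr => j _ do rewrite !blkE.
rewrite [RHS]sig_big_dep /= [RHS](reindex _ tagnat.sig_bij_on) /=.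
by apply: eq_bigr => i _; apply: eq_bigr => j _; rewrite !mxE -tagnat.rankE tagnat.sigK.
Qed.

Lemma fnorm_blk_sqr M : fnorm M ^+ 2 = \sum_(0 <= j < k) fnorm (blk M j) ^+ 2.
Proof. by rewrite fnorm_sqr mdot_blk; apply: eq_bigr => j _; rewrite fnorm_sqr. Qed.

Lemma fnorm_blk M j : fnorm (blk M j) <= fnorm M.
Proof.
have [kj|jk] := leqP k j; first by rewrite blk_out // fnorm0 fnorm_ge0.
rewrite -(@ler_pXn2r _ 2) ?nnegrE ?fnorm_ge0 // fnorm_blk_sqr.
rewrite (@big_cat_nat _ _ _ j) //= ?(ltnW jk) // [X in _ + X]big_ltn //.
have h a b : 0 <= \sum_(a <= i < b) fnorm (blk M i) ^+ 2 by apply: sumr_ge0 => i _; rewrite sqr_ge0.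
by have := h 0%N j; have := h j.+1 k; lra.
Qed.

End blocks.

(** * Smooth and strongly convex functions on a convex set *)

Section calculus.
Context (R : realType) (m n : nat).
Implicit Types (S : set 'M[R]_(m, n)) (f : 'M[R]_(m, n) -> R) (X Y V : 'M[R]_(m, n)).

(** Stands in for the limit s -> 0 in difference quotients. *)
Lemma le_of_le_linear (a b c : R) :
  (forall s, 0 < s <= 1 -> a <= b + c * s) -> a <= b.
Proof.
move=> h; apply/ler_addgt0Pr => e e0.
pose s := Num.min 1 (e / (`|c| + 1)).
have c1 : 0 < `|c| + 1 by rewrite ltr_wpDl.
have s0 : 0 < s <= 1 by rewrite lt_min ltr01 divr_gt0 //= ge_min lexx.
apply: le_trans (h s s0) _; rewrite lerD2l.
case/andP: s0 => s0 _.
have : s * (`|c| + 1) <= e by rewrite -ler_pdivlMr // ge_min lexx orbT.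
apply: le_trans; rewrite mulrC ler_wpM2l ?(ltW s0) //.
by apply: le_trans (ler_norm _) _; rewrite lerDl.
Qed.

Lemma derive_gradient f X V :
  differentiable f X -> 'D_V f X = mdot (gradient f X) V.
Proof.
move=> dfX; rewrite deriveE // {1}(matrix_sum_delta V) linear_sum.
apply: eq_bigr => i _; rewrite linear_sum; apply: eq_bigr => j _.
by rewrite linearZ /= mxE -deriveE // mulrC.
Qed.

Lemma gradientP f X G :
  (forall V, 'D_V f X = mdot G V) -> gradient f X = G.
Proof. by move=> h; apply/matrixP => i j; rewrite mxE h mdotC mdot_delta. Qed.

Lemma is_derive_line f X V (s : R) : differentiable f (X + s *: V) ->
  is_derive s 1 (fun r : R => f (X + r *: V)) (mdot (gradient f (X + s *: V)) V).
Proof.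
move=> df.
have E : (fun h : R => h^-1 *: (((fun r : R => f (X + r *: V)) \o shift s) (h *: 1)
            - f (X + s *: V))) =
         (fun h : R => h^-1 *: ((f \o shift (X + s *: V)) (h *: V) - f (X + s *: V))).
  apply/funext => h /=; congr (_ *: (f _ - _)).
  have -> : h *: (1 : R) = h by exact: mulr1.
  by rewrite scalerDl addrCA.
split; first by rewrite /derivable E; exact: diff_derivable.
by rewrite /derive E -derive_gradient.
Qed.

Definition convex_on S := forall X Y s, S X -> S Y -> 0 <= s <= 1 ->
  S (s *: X + (1 - s) *: Y).

Lemma convex_segment S X Y s : convex_on S -> S X -> S Y -> 0 <= s <= 1 ->
  S (X + s *: (Y - X)).
Proof.
move=> cS SX SY s01; have -> : X + s *: (Y - X) = s *: Y + (1 - s) *: X.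
  by rewrite scalerBr scalerBl scale1r addrCA.
exact: cS.
Qed.

Lemma mean_value S f X Y (r : R) : convex_on S -> S X -> S Y -> 0 <= r <= 1 ->
  (forall Z, S Z -> differentiable f Z) ->
  exists2 c, 0 <= c <= r &
    f (X + r *: (Y - X)) - f X = r * mdot (gradient f (X + c *: (Y - X))) (Y - X).
Proof.
move=> cS SX SY /andP[r0 r1] df; set V := Y - X.
have D s : s \in `[0, r] -> is_derive s 1 (fun q : R => f (X + q *: V))
    (mdot (gradient f (X + s *: V)) V).
  rewrite in_itv /= => /andP[s0 sr]; apply/is_derive_line/df.
  by apply: convex_segment; rewrite // s0 (le_trans sr).
have Do s : s \in `]0, r[ -> is_derive s 1 (fun q : R => f (X + q *: V))
    (mdot (gradient f (X + s *: V)) V).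
  by move=> sr; exact: D (subset_itv_oo_cc sr).
have cont : {within `[0, r], continuous (fun q : R => f (X + q *: V))}.
  by apply: derivable_within_continuous => s /D; case.
have [c cr] := MVT_segment r0 Do cont.
rewrite /= scale0r addr0 subr0 => ->; exists c; last by rewrite mulrC.
by move: cr; rewrite in_itv.
Qed.

(** The upper quadratic bound of an L-smooth function; the mean value theorem
    is applied along the segment after subtracting the two quadratic terms, so
    only the gradient inside S enters. *)
Lemma descent S f L X Y : convex_on S -> S X -> S Y -> smooth_on S L f ->
  f Y <= f X + mdot (gradient f X) (Y - X) + L / 2 * fnorm (Y - X) ^+ 2.
Proof.
move=> cS SX SY [df gl]; set V := Y - X.
pose h := fun q : R => f (X + q *: V) - (mdot (gradient f X) V * q + L / 2 * fnorm V ^+ 2 * q ^+ 2).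
pose dh := fun q : R => mdot (gradient f (X + q *: V)) V
  - (mdot (gradient f X) V + L * fnorm V ^+ 2 * q).
have D s : s \in `[0, (1 : R)] -> is_derive s 1 h (dh s).
  rewrite in_itv /= => s01.
  have ? := is_derive_line (df _ (convex_segment cS SX SY s01)).
  apply: is_derive_eq; rewrite /dh.
  have E (a : R) : (a *: (1 : R)) = a by rewrite /GRing.scale /= mulr1.
  by rewrite -/V !E /GRing.scale /=; field.
have Do s : s \in `]0, (1 : R)[ -> is_derive s 1 h (dh s).
  by move=> sr; exact: D (subset_itv_oo_cc sr).
have cont : {within `[0, (1 : R)], continuous h}.
  by apply: derivable_within_continuous => s /D; case.
have [c c01] := MVT_segment ler01 Do cont.
rewrite {1 2}/h scale1r scale0r addr0 [X + V]subrKC => E.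
have : dh c <= 0.
    rewrite in_itv /= in c01; have SZ := convex_segment cS SX SY c01.
    have := gl _ _ SZ SX; rewrite addrAC subrr add0r -/V fnormZ.
    case/andP: c01 => c0 c1; rewrite ger0_norm // => le.
    have := cauchy_schwarz (gradient f (X + c *: V) - gradient f X) V.
    rewrite mdotDl mdotNl /dh; have := fnorm_ge0 V.
    have := ler_wpM2r (fnorm_ge0 V) le.
    rewrite -/V; lra.
  lra.
Qed.

(** The tangent bound of a strongly convex function.  Smoothness replaces the
    passage to the limit in the difference quotient by an explicit error. *)
Lemma strong_convexity_tangent S f a L X Y : convex_on S -> S X -> S Y ->
  smooth_on S L f -> strongly_convex_on S a f ->
  f X + mdot (gradient f X) (Y - X) + a / 2 * fnorm (Y - X) ^+ 2 <= f Y.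
Proof.
move=> cS SX SY [df gl] sc; set V := Y - X.
apply: (@le_of_le_linear _ _ ((`|L| + a / 2) * fnorm V ^+ 2)) => s /andP[s0 s1].
have s01 : 0 <= s <= 1 by rewrite (ltW s0).
have [c /andP[c0 cs]] := mean_value cS SX SY s01 df.
rewrite -/V => E.
have c01 : 0 <= c <= 1 by rewrite c0 (le_trans cs).
have := gl _ _ SX (convex_segment cS SX SY c01).
rewrite -/V opprD addNKr fnormN fnormZ ger0_norm // => le.
have := cauchy_schwarz (gradient f X - gradient f (X + c *: V)) V.
rewrite mdotDl mdotNl => le2.
have le3 : fnorm (gradient f X - gradient f (X + c *: V)) * fnorm V <= `|L| * s * fnorm V ^+ 2.
  apply: le_trans (ler_wpM2r (fnorm_ge0 V) le) _.
  rewrite expr2 !mulrA ler_wpM2r ?fnorm_ge0 // ler_wpM2r ?fnorm_ge0 //.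
  apply: le_trans (ler_wpM2r c0 (ler_norm L)) _.
  by rewrite ler_wpM2l.
have := sc _ _ s SY SX s01; rewrite -/V.
have -> : s *: Y + (1 - s) *: X = X + s *: V.
  by rewrite /V scalerBr scalerBl scale1r addrCA.
move=> le4.
have : s * (f X + mdot (gradient f X) V + a / 2 * fnorm V ^+ 2) <=
       s * (f Y + (`|L| + a / 2) * fnorm V ^+ 2 * s).
  have := ler_wpM2l (ltW s0) (le_trans le2 le3); nra.
by rewrite ler_pM2l.
Qed.

(** Compare X with the points of the segment towards Y and let them tend to X. *)
Lemma argmin_strongly_convex S (g : 'M[R]_(m, n) -> R) a X Y :
  convex_on S -> strongly_convex_on S a g -> is_argmin S g X -> S Y ->
  g X + a / 2 * fnorm (Y - X) ^+ 2 <= g Y.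
Proof.
move=> cS sc [SX mX] SY.
apply: (@le_of_le_linear _ _ (a / 2 * fnorm (Y - X) ^+ 2)) => s /andP[s0 s1].
have s01 : 0 <= s <= 1 by rewrite (ltW s0).
have := mX _ (cS _ _ _ SY SX s01); have := sc _ _ _ SY SX s01 => h1 h2.
have := le_trans h2 h1 => h3.
have : s * (g X + a / 2 * fnorm (Y - X) ^+ 2) <= s * (g Y + a / 2 * fnorm (Y - X) ^+ 2 * s) by lra.
by rewrite ler_pM2l.
Qed.

(** One proximal gradient step: compare the prox objective at its minimizer Z
    and at the minimizer Xs of the composite objective; smoothness absorbs the
    distance from Y to Z because the step satisfies L eta <= 1, and strong
    convexity of the smooth part leaves the factor 1 - a eta. *)
Lemma prox_contraction S (F g : 'M[R]_(m, n) -> R) (G : 'M[R]_(m, n) -> 'M[R]_(m, n))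
    (a L eta : R) Y Z Xs :
  convex_on S -> strongly_convex_on S 0 g -> 0 < eta -> L * eta <= 1 ->
  (forall X Y, S X -> S Y ->
     F X + mdot (G X) (Y - X) + a / 2 * fnorm (Y - X) ^+ 2 <= F Y) ->
  (forall X Y, S X -> S Y ->
     F Y <= F X + mdot (G X) (Y - X) + L / 2 * fnorm (Y - X) ^+ 2) ->
  S Y ->
  is_argmin S (fun Z => g Z + (2 * eta)^-1 * fnorm (Z - (Y - eta *: G Y)) ^+ 2) Z ->
  is_argmin S (fun Z => F Z + g Z) Xs ->
  fnorm (Z - Xs) ^+ 2 <= (1 - a * eta) * fnorm (Y - Xs) ^+ 2.
Proof.
move=> cS cg eta0 Leta low upp SY mZ [SXs mXs].
have sc : strongly_convex_on S (eta^-1)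
    (fun Z => g Z + (2 * eta)^-1 * fnorm (Z - (Y - eta *: G Y)) ^+ 2).
  move=> A B s SA SB s01; rewrite fnorm_conv_sqr invfM.
  by have := cg A B s SA SB s01; set u := eta^-1; lra.
have SZ := mZ.1.
have e1 := argmin_strongly_convex cS sc mZ SXs.
have e2 := mXs _ SZ; have e3 := low _ _ SY SXs; have e4 := upp _ _ SY SZ.
have nx A : fnorm (A - (Y - eta *: G Y)) ^+ 2 =
    fnorm (A - Y) ^+ 2 + 2 * eta * mdot (G Y) (A - Y) + eta ^+ 2 * fnorm (G Y) ^+ 2.
  rewrite opprB addrCA [A - Y as X in _ + X]addrC.
  rewrite (addrC (eta *: _)) !fnorm_sqr !mdotE !(mdotC (G Y)); ring.
move: e1; rewrite !nx => e1.
have {}e1 : 2 * eta * g Z + fnorm (Z - Y) ^+ 2 + 2 * eta * mdot (G Y) (Z - Y)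
     + fnorm (Xs - Z) ^+ 2 <=
   2 * eta * g Xs + fnorm (Xs - Y) ^+ 2 + 2 * eta * mdot (G Y) (Xs - Y).
  have p : 0 <= 2 * eta by lra.
  have := ler_wpM2l p e1; rewrite invfM.
  set u := eta^-1; have uE : eta * u = 1 by rewrite mulfV ?gt_eqF.
  have c1 x : 2 * eta * (2^-1 * u * x) = x by rewrite -[RHS]mul1r -[X in _ = X * _]uE; field.
  have c2 x : 2 * eta * (u / 2 * x) = x by rewrite -[RHS]mul1r -[X in _ = X * _]uE; field.
  by rewrite !mulrDr !c1 !c2; lra.
rewrite (fnormBC Z Xs) (fnormBC Y Xs).
have := ler_wpM2l (ltW eta0) e2; have := ler_wpM2l (ltW eta0) e3.
have := ler_wpM2l (ltW eta0) e4.
have := ler_wpM2r (sqr_ge0 (fnorm (Z - Y))) Leta.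
lra.
Qed.

End calculus.

(** * Gradients of block-separable functions *)

Section separable.
Context (R : realType) (k p n : nat).

(** Directional derivatives are computed block by block, because a line in the
    window projects to a line in each block; the matrix with these blocks is then
    the gradient. *)
Lemma gradient_separable (g : nat -> 'M[R]_(p, n) -> R) (Y V : blocks R k p n) :
  (forall j, (j < k)%N -> differentiable (g j) (blk Y j)) ->
  mdot (gradient (fun Z : blocks R k p n => \sum_(0 <= j < k) g j (blk Z j)) Y) V =
  \sum_(0 <= j < k) mdot (gradient (g j) (blk Y j)) (blk V j).
Proof.
move=> dg; pose G : blocks R k p n := \mxcol_(j < k) gradient (g j) (blk Y j).
have blkG (j : 'I_k) : blk G j = gradient (g j) (blk Y j) by rewrite blkE mxcolK.
have -> : gradient (fun Z : blocks R k p n => \sum_(0 <= j < k) g j (blk Z j)) Y = G.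
  apply: gradientP => W; rewrite mdot_blk !big_mkord.
  have -> : (fun Z : blocks R k p n => \sum_(0 <= j < k) g j (blk Z j)) =
            \sum_(j < k) (fun Z : blocks R k p n => g j (blk Z j)).
    by apply/funext => Z; rewrite fct_sumE big_mkord.
  have D (j : 'I_k) : is_derive Y W (fun Z : blocks R k p n => g j (blk Z j))
      (mdot (blk G j) (blk W j)).
    have E : (fun h : R => h^-1 *: (((fun Z : blocks R k p n => g j (blk Z j)) \o shift Y) (h *: W)
                - g j (blk Y j))) =
             (fun h : R => h^-1 *: ((g j \o shift (blk Y j)) (h *: blk W j) - g j (blk Y j))).
      by apply/funext => h /=; rewrite blkP.
    split; first by rewrite /derivable E; exact/diff_derivable/dg.
    by rewrite /derive E blkG -derive_gradient //; exact: dg.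
  by rewrite derive_val.
by rewrite mdot_blk !big_mkord; apply: eq_bigr => j _; rewrite blkG.
Qed.

End separable.

(** * Expectation of bounded measurable functions *)

Section expectation.
Context (R : realType) (d : measure_display) (Omega : measurableType d).
Context (P : probability Omega R).
Implicit Types f g : Omega -> R.

Definition bmeas f := measurable_fun [set: Omega] f /\ exists B, forall omega, `|f omega| <= B.

Definition mean f : R := fine 'E_P[f]%E.

Lemma bmeas_integrable f : bmeas f -> P.-integrable [set: Omega] (EFin \o f).
Proof.
move=> [mf [B fB]]; apply: measurable_bounded_integrable => //.
  exact: (le_lt_trans (probability_le1 P measurableT) (ltry _)).
exists B; split; rewrite ?num_real // => x Bx omega _ /=.
exact: le_trans (fB omega) (ltW Bx).
Qed.

Lemma bmeas_cst c : bmeas (fun=> c).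
Proof. by split; [exact: measurable_cst | exists `|c|]. Qed.

Lemma bmeasD f g : bmeas f -> bmeas g -> bmeas (fun omega => f omega + g omega).
Proof.
move=> [mf [B fB]] [mg [C gC]]; split; first exact: measurable_funD.
by exists (B + C) => omega; apply: le_trans (ler_normD _ _) (lerD _ _).
Qed.

Lemma bmeasM f g : bmeas f -> bmeas g -> bmeas (fun omega => f omega * g omega).
Proof.
move=> [mf [B fB]] [mg [C gC]]; split; first exact: measurable_funM.
by exists (B * C) => omega; rewrite normrM ler_pM.
Qed.

Lemma bmeasZ c f : bmeas f -> bmeas (fun omega => c * f omega).
Proof. by apply: bmeasM; exact: bmeas_cst. Qed.

Lemma bmeasB f g : bmeas f -> bmeas g -> bmeas (fun omega => f omega - g omega).
Proof.
move=> nf ng; have := bmeasD nf (bmeasZ (-1) ng).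
by congr bmeas; apply/funext => omega; rewrite mulN1r.
Qed.

Lemma bmeas_sum (I : Type) (s : seq I) (Q : pred I) (F : I -> Omega -> R) :
  (forall i, Q i -> bmeas (F i)) -> bmeas (fun omega => \sum_(i <- s | Q i) F i omega).
Proof.
move=> nF; elim: s => [|i s IH].
  by under eq_fun do rewrite big_nil; exact: bmeas_cst.
case Qi: (Q i); under eq_fun do rewrite big_cons Qi; last by [].
by apply: bmeasD => //; exact: nF.
Qed.

Lemma meanE f : bmeas f -> ('E_P[f] = (mean f)%:E)%E.
Proof.
move=> nf; rewrite /mean fineK // unlock.
exact: (integrable_fin_num _ (bmeas_integrable nf)).
Qed.

Lemma mean_Rintegral f : mean f = (\int[P]_omega f omega)%R.
Proof. by rewrite /mean unlock. Qed.

Lemma mean_cst c : mean (fun=> c) = c.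
Proof. by rewrite /mean (expectation_cst P c). Qed.

Lemma meanD f g : bmeas f -> bmeas g ->
  mean (fun omega => f omega + g omega) = mean f + mean g.
Proof.
by move=> nf ng; rewrite !mean_Rintegral RintegralD //; exact: bmeas_integrable.
Qed.

Lemma meanZ c f : bmeas f -> mean (fun omega => c * f omega) = c * mean f.
Proof.
by move=> nf; rewrite !mean_Rintegral RintegralZl //; exact: bmeas_integrable.
Qed.

Lemma meanB f g : bmeas f -> bmeas g ->
  mean (fun omega => f omega - g omega) = mean f - mean g.
Proof.
by move=> nf ng; rewrite !mean_Rintegral RintegralB //; exact: bmeas_integrable.
Qed.

Lemma mean_sum (I : Type) (s : seq I) (Q : pred I) (F : I -> Omega -> R) :
  (forall i, Q i -> bmeas (F i)) ->
  mean (fun omega => \sum_(i <- s | Q i) F i omega) = \sum_(i <- s | Q i) mean (F i).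
Proof.
move=> nF; elim: s => [|i s IH].
  by under eq_fun do rewrite big_nil; rewrite mean_cst big_nil.
rewrite big_cons -IH; case Qi: (Q i); under eq_fun do rewrite big_cons Qi; last by [].
by rewrite meanD //; [exact: nF | exact: bmeas_sum].
Qed.

Lemma le_mean f g : bmeas f -> bmeas g -> (forall omega, f omega <= g omega) ->
  mean f <= mean g.
Proof.
move=> nf ng fg; rewrite !mean_Rintegral le_Rintegral //; exact: bmeas_integrable.
Qed.

Lemma mean_norm_le f c : bmeas f -> (forall omega, `|f omega| <= c) -> `|mean f| <= c.
Proof.
move=> nf fc; have fcs omega : - c <= f omega <= c by rewrite -ler_norml.
rewrite ler_norml -{1}(mean_cst (- c)) -{2}(mean_cst c).
by apply/andP; split; apply: le_mean => //; try exact: bmeas_cst;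
  move=> omega; case/andP: (fcs omega).
Qed.

(** Independence passes from events to expectations because the joint law of
    (f, g) is the product of the marginal laws, by uniqueness of the product
    measure, and Fubini's theorem applies. *)
Lemma mean_indep f g : bmeas f -> bmeas g ->
  (forall A B : set R, measurable A -> measurable B ->
     P (f @^-1` A `&` g @^-1` B) = (P (f @^-1` A) * P (g @^-1` B))%E) ->
  mean (fun omega => f omega * g omega) = mean f * mean g.
Proof.
move=> nf ng ind.
have [mf _] := nf; have [mg _] := ng.
pose X : {mfun Omega >-> R} := mfun_Sub (mem_set mf).
pose Y : {mfun Omega >-> R} := mfun_Sub (mem_set mg).
have mXY : measurable_fun [set: Omega] (fun omega => (X omega, Y omega)).
  exact: measurable_fun_pair.
pose XY : {mfun Omega >-> (R * R)%type} :=
  mfun_Sub (mem_set mXY).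
pose h (z : R * R) := (z.1 * z.2)%:E : \bar R.
have mh : measurable_fun setT h.
  apply/measurable_EFinP; apply: measurable_funM.
    exact: measurable_fst.
  exact: measurable_snd.
have EXY A : measurable A ->
    distribution P XY A = (distribution P X \x distribution P Y)%E A.
  move=> mA; rewrite (@product_measure_unique _ _ _ _ _ (distribution P X)
      (distribution P Y) (distribution P XY)) //.
have ih : P.-integrable [set: Omega] (h \o XY) by exact: bmeas_integrable (bmeasM nf ng).
have ihd : (distribution P XY).-integrable setT h.
  apply/integrableP; split => //; rewrite ge0_integral_distribution //.
    by have /integrableP[] := ih.
  exact: measurableT_comp.
have ihp : ((distribution P X \x distribution P Y)%E).-integrable setT h.
  apply/integrableP; split => //.
  rewrite (eq_measure_integral (distribution P XY)); first by have /integrableP[] := ihd.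
  by move=> A mA _; apply/esym; exact: EXY.
have E : ('E_P[fun omega => (f omega * g omega)%R] =
          \int[distribution P X]_x \int[distribution P Y]_y h (x, y))%E.
  rewrite integral12_prod_meas1 // (eq_measure_integral (distribution P XY)).
    by rewrite integral_distribution // unlock.
  by move=> A mA _; apply/esym; exact: EXY.
have iX : (distribution P X).-integrable setT (EFin : R -> \bar R).
  apply/integrableP; split; first exact/measurable_EFinP.
  rewrite ge0_integral_distribution //.
    by have /integrableP[] := bmeas_integrable nf.
  by apply: measurableT_comp => //; exact/measurable_EFinP.
have iY : (distribution P Y).-integrable setT (EFin : R -> \bar R).
  apply/integrableP; split; first exact/measurable_EFinP.
  rewrite ge0_integral_distribution //.
    by have /integrableP[] := bmeas_integrable ng.
  by apply: measurableT_comp => //; exact/measurable_EFinP.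
have EY : (\int[distribution P Y]_y y%:E = (mean g)%:E)%E.
  rewrite integral_distribution //; first by rewrite -meanE // unlock.
  exact: bmeas_integrable.
have EX : (\int[distribution P X]_x x%:E = (mean f)%:E)%E.
  rewrite integral_distribution //; first by rewrite -meanE // unlock.
  exact: bmeas_integrable.
apply: EFin_inj; rewrite -meanE; last exact: bmeasM.
rewrite E EFinM.
under eq_integral => x _.
  rewrite /h /=; under eq_integral => y _ do rewrite EFinM.
  rewrite integralZl // EY muleC.
  over.
by rewrite integralZl // EX muleC.
Qed.

End expectation.

(** * Continuous functions of random vectors *)

Section measurability.
Context (R : realType) (d : measure_display) (Omega : measurableType d).

(** Rounding every coordinate down to a multiple of 1/(m+1) makes the argument
    take countably many values, so that the composite is measurable whatever c
    is; continuity is used only to let m tend to infinity. *)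
Lemma measurable_continuous_comp n (c : 'cV[R]_n -> R) (Z : Omega -> 'cV[R]_n) :
  continuous c -> (forall i, measurable_fun [set: Omega] (fun omega => Z omega i ord0)) ->
  measurable_fun [set: Omega] (fun omega => c (Z omega)).
Proof.
move=> cc mZ.
pose a (m : nat) : R := m.+1%:R.
have a0 m : 0 < a m by rewrite ltr0n.
pose q m (K : 'cV[int]_n) : 'cV[R]_n := \col_i ((K i ord0)%:~R / a m).
pose fl m (z : 'cV[R]_n) : 'cV[int]_n := \col_i Num.floor (a m * z i ord0).
apply: (@measurable_fun_cvg _ _ _ _ (fun m omega => c (q m (fl m (Z omega))))).
  move=> m _ B mB; rewrite setTI.
  pose A (j : nat) : set Omega := if (unpickle j : option 'cV[int]_n) is Some K then
    (if `[< B (c (q m K)) >] then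
       \bigcap_(i in [set: 'I_n]) [set omega | Num.floor (a m * Z omega i ord0) = K i ord0]
     else set0) else set0.
  suff -> : (fun omega => c (q m (fl m (Z omega)))) @^-1` B = \bigcup_j A j.
    apply: bigcupT_measurable => j; rewrite /A; case: unpickle => [K|]; last exact: measurable0.
    case: asboolP => [_|]; last by move=> _; exact: measurable0.
    apply: fin_bigcap_measurable => // i _.
    have -> : [set omega | Num.floor (a m * Z omega i ord0) = K i ord0] =
        (fun omega => a m * Z omega i ord0) @^-1` `[(K i ord0)%:~R, (K i ord0 + 1)%:~R[%classic.
      apply/seteqP; split => omega /=; rewrite in_itv /=.
        by move=> <-; rewrite floor_itv.
      by move=> h; exact: floor_def.
    rewrite -[X in measurable X]setTI.
    apply: (measurable_funM (measurable_cst (a m)) (mZ i)) => //.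
  apply/seteqP; split => omega /=.
    move=> Bo; exists (pickle (fl m (Z omega))) => //; rewrite /A pickleK asboolT //.
    by move=> i _; rewrite /= mxE.
  case=> j _; rewrite /A; case: unpickle => // K; case: asboolP => // BK h.
  suff -> : fl m (Z omega) = K by [].
  by apply/colP => i; rewrite mxE; exact: h.
move=> omega _; apply: (cvg_comp (fun m => q m (fl m (Z omega))) c); last exact: cc.
set z := Z omega; apply/cvgrPdist_le => e e0.
near=> m.
have em : (a m)^-1 <= e.
  by apply: ltW; near: m; exact: near_infty_natSinv_lt (PosNum e0).
rewrite [leLHS]mx_normrE; apply: bigmax_le => [|[i j] _ /=]; first exact: ltW.
rewrite !mxE (ord1 j); apply: le_trans em.
have /andP[f1 f2] := floor_itv (a m * z i ord0).
move: f1 f2; rewrite intrD; set f := (Num.floor _)%:~R => f1 f2.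
have -> : z i ord0 - f / a m = (a m * z i ord0 - f) / a m.
  by rewrite mulrBl mulrAC mulfV ?mul1r // gt_eqF.
rewrite normrM [X in _ * X]gtr0_norm ?invr_gt0 // ger0_norm ?subr_ge0 //.
by rewrite -[leRHS]mul1r ler_pM2r ?invr_gt0 //; rewrite mulr1z in f2; lra.
Unshelve. all: by end_near. Qed.

Definition vbmeas m n (X : Omega -> 'M[R]_(m, n)) : Prop :=
  forall i j, bmeas (fun omega => X omega i j).

Lemma vbmeas_cst m n (A : 'M[R]_(m, n)) : vbmeas (fun=> A).
Proof. by move=> i j; exact: bmeas_cst. Qed.

Lemma vbmeasD m n (X Y : Omega -> 'M[R]_(m, n)) :
  vbmeas X -> vbmeas Y -> vbmeas (fun omega => X omega + Y omega).
Proof. by move=> nX nY i j; under eq_fun do rewrite mxE; exact: bmeasD. Qed.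

Lemma vbmeas_mulmx m n p (A : 'M[R]_(m, n)) (X : Omega -> 'M[R]_(n, p)) :
  vbmeas X -> vbmeas (fun omega => A *m X omega).
Proof.
move=> nX i j; under eq_fun do rewrite mxE.
by apply: bmeas_sum => k _; exact: bmeasZ.
Qed.

Lemma vbmeasN m n (X : Omega -> 'M[R]_(m, n)) :
  vbmeas X -> vbmeas (fun omega => - X omega).
Proof.
move=> nX i j; under eq_fun do rewrite mxE -mulN1r.
exact: bmeasZ.
Qed.

Lemma vbmeas_sum m n (I : Type) (s : seq I) (Q : pred I) (F : I -> Omega -> 'M[R]_(m, n)) :
  (forall i, Q i -> vbmeas (F i)) -> vbmeas (fun omega => \sum_(i <- s | Q i) F i omega).
Proof.
move=> nF i j; under eq_fun do rewrite summxE.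
by apply: bmeas_sum => k Qk; exact: nF.
Qed.

Lemma vbmeas_col m1 m2 n (X : Omega -> 'M[R]_(m1, n)) (Y : Omega -> 'M[R]_(m2, n)) :
  vbmeas X -> vbmeas Y -> vbmeas (fun omega => col_mx (X omega) (Y omega)).
Proof.
move=> nX nY i j; case: (split_ordP i) => k ->.
  by under eq_fun do rewrite col_mxEu.
by under eq_fun do rewrite col_mxEd.
Qed.

Lemma bmeas_mdot m n (X Y : Omega -> 'M[R]_(m, n)) :
  vbmeas X -> vbmeas Y -> bmeas (fun omega => mdot (X omega) (Y omega)).
Proof.
move=> nX nY; apply: bmeas_sum => i _; apply: bmeas_sum => j _.
exact: bmeasM.
Qed.

End measurability.

(** * Energy of independent centred noise *)

Section noise_energy.
Context (R : realType) (d : measure_display) (Omega : measurableType d).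
Context (P : probability Omega R) (n : nat) (w : nat -> Omega -> 'cV[R]_n).
Context (sig wb : R).
Hypothesis mw : forall t, vec_measurable (w t).
Hypothesis iw : mutually_independent P w.
Hypothesis w0 : forall t i, ('E_P[fun omega => w t omega i ord0] = 0)%E.
Hypothesis cw : forall t, psd_le (sig ^+ 2)%:M (second_moment P (w t)).
Hypothesis bw : forall t omega, fnorm (w t omega) <= wb.

Lemma vbmeas_noise t : vbmeas (w t).
Proof.
move=> i j; rewrite (ord1 j); split; first exact: mw.
by exists wb => omega; apply: le_trans (bw t omega); exact: fnorm_entry.
Qed.

Lemma noise_uncorrelated s t i j : s != t ->
  mean P (fun omega => w s omega i ord0 * w t omega j ord0) = 0.
Proof.
move=> st; rewrite mean_indep; try exact: vbmeas_noise.
  by rewrite /mean w0 mul0r.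
move=> A B mA mB.
pose D k : set (n.-tuple R) :=
  if k == s then (@tnth n R ^~ i) @^-1` A else (@tnth n R ^~ j) @^-1` B.
have mD k : measurable (D k).
  by rewrite /D; case: ifP => _; rewrite -[X in measurable X]setTI; exact: measurable_tnth.
have u : uniq [:: s; t] by rewrite /= inE st.
have := iw u mD; rewrite big_cons big_seq1.
have -> : \bigcap_(j0 in [set` [:: s; t]]) vec_event (w j0) (D j0) =
    vec_event (w s) (D s) `&` vec_event (w t) (D t).
  apply/seteqP; split => omega /=.
    by move=> h; split; apply: h; rewrite /= !inE eqxx ?orbT.
  by move=> [h1 h2] k; rewrite /= !inE => /orP[] /eqP ->.
have Es : vec_event (w s) (D s) = (fun omega => w s omega i ord0) @^-1` A.
  by apply/seteqP; split => omega; rewrite /vec_event /D /= eqxx /= tnth_mktuple.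
have Et : vec_event (w t) (D t) = (fun omega => w t omega j ord0) @^-1` B.
  apply/seteqP; split => omega; rewrite /vec_event /D /= eq_sym (negPf st) /=;
    by rewrite tnth_mktuple.
by rewrite Es Et.
Qed.

Lemma noise_bilinear m (C D : 'M[R]_(m, n)) s t :
  mean P (fun omega => mdot (C *m w s omega) (D *m w t omega)) =
  \sum_(r < m) \sum_(a < n) \sum_(b < n)
    C r a * D r b * mean P (fun omega => w s omega a ord0 * w t omega b ord0).
Proof.
pose F r a b omega := C r a * D r b * (w s omega a ord0 * w t omega b ord0).
have bF r a b : bmeas (F r a b).
  by apply/bmeasZ/bmeasM; exact: vbmeas_noise.
have -> : (fun omega => mdot (C *m w s omega) (D *m w t omega)) =
    (fun omega => \sum_(r < m) \sum_(a < n) \sum_(b < n) F r a b omega).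
  apply/funext => omega; apply: eq_bigr => r _; rewrite big_ord1 !mxE mulr_suml.
  apply: eq_bigr => a _; rewrite mulr_sumr; apply: eq_bigr => b _.
  by rewrite /F mulrACA.
rewrite mean_sum => [|r _]; last by do 2 (apply: bmeas_sum => ? _).
apply: eq_bigr => r _; rewrite mean_sum => [|a _]; last by apply: bmeas_sum => ? _.
apply: eq_bigr => a _; rewrite mean_sum //.
apply: eq_bigr => b _; rewrite meanZ //.
by apply: bmeasM; exact: vbmeas_noise.
Qed.

(** The second moment matrix dominates sigma^2 I; it is tested against each row of C. *)
Lemma noise_energy1 m (C : 'M[R]_(m, n)) t :
  sig ^+ 2 * fnorm C ^+ 2 <=
  mean P (fun omega => mdot (C *m w t omega) (C *m w t omega)).
Proof.
rewrite noise_bilinear fnorm_sqr /mdot mulr_sumr; apply: ler_sum => r _.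
have := cw t ((row r C)^T); rewrite trmxK => h.
rewrite -subr_ge0; congr (0 <= _): h.
rewrite mulmxBr mulmxBl !mxE; congr (_ - _).
  under eq_bigr => b _ do rewrite !mxE mulr_suml.
  rewrite exchange_big; apply: eq_bigr => a _; apply: eq_bigr => b _.
  by rewrite !mxE /mean mulrAC.
rewrite mulr_sumr; apply: eq_bigr => a _.
by rewrite -scalemx1 -scalemxAr mulmx1 !mxE mulrA.
Qed.

(** The cross terms vanish because distinct noises are independent and
    centred. *)
Lemma noise_energy m k (C : 'I_k -> 'M[R]_(m, n)) (tau : 'I_k -> nat) :
  injective tau ->
  sig ^+ 2 * (\sum_(i < k) fnorm (C i) ^+ 2) <=
  mean P (fun omega => fnorm (\sum_(i < k) C i *m w (tau i) omega) ^+ 2).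
Proof.
move=> inj.
pose F i j omega := mdot (C i *m w (tau i) omega) (C j *m w (tau j) omega).
have bF i j : bmeas (F i j) by apply: bmeas_mdot; apply: vbmeas_mulmx; exact: vbmeas_noise.
have -> : (fun omega => fnorm (\sum_(i < k) C i *m w (tau i) omega) ^+ 2) =
    (fun omega => \sum_(i < k) \sum_(j < k) F i j omega).
  apply/funext => omega; rewrite fnorm_sqr.
  have S1 X : mdot (\sum_(i < k) C i *m w (tau i) omega) X =
      \sum_(i < k) mdot (C i *m w (tau i) omega) X.
    by elim/big_rec2: _ => [|i ? ? _ <-]; rewrite ?mdotDl // -(scale0r 0) mdotZl mul0r.
  by rewrite S1; apply: eq_bigr => i _; rewrite mdotC S1; apply: eq_bigr => j _; rewrite mdotC.
rewrite mean_sum => [|i _]; last exact: bmeas_sum.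
rewrite mulr_sumr; apply: ler_sum => i _; rewrite mean_sum // (bigD1 i) //=.
rewrite [X in _ + X]big1 ?addr0; first exact: noise_energy1.
move=> j ji; rewrite /F noise_bilinear big1 // => r _; rewrite big1 // => a _.
rewrite big1 // => b _; rewrite noise_uncorrelated ?mulr0 //.
by rewrite (inj_eq inj) eq_sym.
Qed.

End noise_energy.

(** * Complex norms and powers of the closed loop *)

Section complex_norms.
Context (R : realType).
Local Notation normc := (@ComplexField.Normc.normc R).

Lemma normc_ge0 (z : R[i]) : 0 <= normc z.
Proof. by case: z => a b; exact: sqrtr_ge0. Qed.

Lemma normc_real (a : R) : normc (real_complex R a) = `|a|.
Proof. by rewrite /= expr0n addr0 sqrtr_sqr. Qed.

Lemma normc_sum (I : Type) (s : seq I) (F : I -> R[i]) :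
  normc (\sum_(i <- s) F i) <= \sum_(i <- s) normc (F i).
Proof.
elim/big_rec2: _ => [|i x y _ le]; first by rewrite ComplexField.Normc.normc0.
by apply: le_trans (le_normcD _ _) _; rewrite lerD2l.
Qed.

Lemma fnormC_ge0 m n (A : 'M[R[i]]_(m, n)) : 0 <= fnormC A.
Proof. exact: sqrtr_ge0. Qed.

Lemma fnormC_real m n (A : 'M[R]_(m, n)) : fnormC (map_mx (real_complex R) A) = fnorm A.
Proof.
congr Num.sqrt; apply: eq_bigr => i _; apply: eq_bigr => j _.
by rewrite mxE normc_real real_normK ?num_real.
Qed.

Lemma fnormCZ m n a (A : 'M[R[i]]_(m, n)) : fnormC (a *: A) = normc a * fnormC A.
Proof.
rewrite /fnormC.
under eq_bigr => i _ do under eq_bigr => j _ do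
  rewrite mxE ComplexField.Normc.normcM exprMn.
under eq_bigr => i _ do rewrite -mulr_sumr.
by rewrite -mulr_sumr sqrtrM ?sqr_ge0 // sqrtr_sqr ger0_norm ?normc_ge0.
Qed.

Lemma fnormC0 m n : fnormC (0 : 'M[R[i]]_(m, n)) = 0.
Proof. by rewrite -(scale0r 0) fnormCZ ComplexField.Normc.normc0 mul0r. Qed.

Lemma fnormC_entry m n (A : 'M[R[i]]_(m, n)) i j : normc (A i j) <= fnormC A.
Proof.
rewrite -[leLHS](ger0_norm (normc_ge0 _)) -sqrtr_sqr ler_wsqrtr //.
rewrite (bigD1 i) //= (bigD1 j) //= -addrA lerDl addr_ge0 //.
  by apply: sumr_ge0 => k _; rewrite sqr_ge0.
by apply: sumr_ge0 => k _; apply: sumr_ge0 => l _; rewrite sqr_ge0.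
Qed.

Lemma fnormC_eq0 m n (A : 'M[R[i]]_(m, n)) : fnormC A = 0 -> A = 0.
Proof.
move=> A0; apply/matrixP => i j; rewrite mxE.
apply: ComplexField.Normc.eq0_normc; apply/eqP.
by rewrite eq_le normc_ge0 andbT -A0 fnormC_entry.
Qed.

(** The Euclidean norm is below the sum norm: enough for operator norms to be
    finite, without a complex Cauchy-Schwarz inequality. *)
Lemma fnormC_le_sum n (v : 'cV[R[i]]_n) : fnormC v <= \sum_i normc (v i ord0).
Proof.
have s0 : 0 <= \sum_i normc (v i ord0) by apply: sumr_ge0 => i _; exact: normc_ge0.
rewrite -[leRHS](ger0_norm s0) -sqrtr_sqr ler_wsqrtr //.
rewrite expr2 mulr_sumr; apply: ler_sum => i _; rewrite big_ord1 expr2.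
rewrite ler_wpM2r ?normc_ge0 // (bigD1 i) //= lerDl.
by apply: sumr_ge0 => j _; exact: normc_ge0.
Qed.

Lemma opnormCP m n (A : 'M[R[i]]_(m, n)) (v : 'cV[R[i]]_n) :
  fnormC (A *m v) <= opnormC A * fnormC v.
Proof.
have unit (u : 'cV[R[i]]_n) : fnormC u <= 1 -> fnormC (A *m u) <= opnormC A.
  move=> u1; apply: sup_upper_bound; last by exists u.
  split; first by exists (fnormC (A *m u)); exists u.
  exists (\sum_i \sum_j normc (A i j)) => _ [x /= x1 <-].
  apply: le_trans (fnormC_le_sum _) _; apply: ler_sum => i _; rewrite mxE.
  apply: le_trans (normc_sum _ _) _; apply: ler_sum => j _.
  rewrite ComplexField.Normc.normcM ler_piMr ?normc_ge0 //.
  exact: le_trans (fnormC_entry _ _ _) x1.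
have [v0|v0] := eqVneq (fnormC v) 0.
  by rewrite (fnormC_eq0 v0) mulmx0 !fnormC0 mulr0.
have nv : 0 < fnormC v by rewrite lt_neqAle fnormC_ge0 eq_sym v0.
have := unit (real_complex R (fnormC v)^-1 *: v).
rewrite -scalemxAr !fnormCZ normc_real ger0_norm ?invr_ge0 ?fnormC_ge0 //.
rewrite mulVf // => /(_ (lexx _)).
by rewrite mulrC ler_pdivrMr.
Qed.

Lemma opnormC_ge0 m n (A : 'M[R[i]]_(m, n)) : 0 <= opnormC A.
Proof.
rewrite /opnormC; set E := (X in sup X).
have [[_ ub]|ns] := pselect (has_sup E); last by rewrite sup_out.
apply: le_trans (fnormC_ge0 (A *m (0 : 'cV_n))) _; apply: ub_le_sup => //.
by exists 0 => //=; rewrite fnormC0.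
Qed.

Lemma opnormC_le_mul m n (A : 'M[R[i]]_(m, n)) c (v : 'cV[R[i]]_n) :
  opnormC A <= c -> fnormC (A *m v) <= c * fnormC v.
Proof.
move=> Ac; apply: le_trans (opnormCP _ _) _.
by rewrite ler_wpM2r ?fnormC_ge0.
Qed.

End complex_norms.

(** Diagonalisation turns powers of the closed-loop matrix into powers of the
    contraction Lam, so the conditioning of Q is paid only once. *)
Lemma strongly_stable_pow (R : realType) dx du (k : constants R)
    (S : problem R dx du) n (v : 'cV[R]_dx) :
  strongly_stable k S -> 0 <= gamma k <= 1 ->
  fnorm (AK S ^+ n *m v) <= kappa k ^+ 2 * (1 - gamma k) ^+ n * fnorm v.
Proof.
move=> [Q [Lam [uQ _ AKE nL [_ nQ nQi]]]] /andP[g0 g1].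
have pow : map_mx (real_complex R) (AK S ^+ n) = Q *m (Lam ^+ n) *m invmx Q.
  elim: n => [|n IH]; first by rewrite !expr0 mulmx1 mulmxV // map_mx1.
  rewrite exprS map_mxM IH AKE -!mulmxA; congr (Q *m _).
  by rewrite [invmx Q *m _]mulmxA mulVmx // mul1mx exprS mulmxA.
have powL (u : 'cV[R[i]]_dx) : fnormC (Lam ^+ n *m u) <= (1 - gamma k) ^+ n * fnormC u.
  elim: n {pow} => [|n IH]; first by rewrite expr0 mul1mx mul1r.
  rewrite exprS -mulmxA; apply: le_trans (opnormC_le_mul _ nL) _.
  by rewrite exprS -mulrA ler_wpM2l // subr_ge0.
have k0 : 0 <= kappa k by exact: le_trans (opnormC_ge0 Q) nQ.
rewrite -!fnormC_real map_mxM pow -!mulmxA.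
apply: le_trans (opnormC_le_mul _ nQ) _; rewrite expr2 -!mulrA ler_wpM2l //.
apply: le_trans (powL _) _; rewrite mulrCA ler_wpM2l ?exprn_ge0 ?subr_ge0 //.
exact: opnormC_le_mul.
Qed.

(** * True and truncated trajectories *)

(** The standing assumptions, together with the positivity of the denominator
    in the radius D, which holds as soon as the memory H is long enough. *)
Record standing (R : realType) dx du (k : constants R) (S : problem R dx du)
    (H : nat) : Prop := Standing {
  st_const : admissible_constants k;
  st_noise : disturbance_assumption k S;
  st_stable : strongly_stable k S;
  st_radius : 0 < 1 - kappa k ^+ 2 * (1 - gamma k) ^+ H.+1 }.

Section trajectories.
Context (R : realType) (dx du : nat) (k : constants R) (S : problem R dx du).
Context (H : nat).
Hypothesis st : standing k S H.
Let hk := st_const st.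
Let hn := st_noise st.
Let hs := st_stable st.
Let hD := st_radius st.

Local Notation dac := (blocks R H du dx).
Implicit Types (N : nat -> dac) (omega : Omega S).

(** The disturbance feedback keeping m noises: m = H in the true action, while
    m is the memory in the truncated one. *)
Definition dac_noise (m : nat) N t omega : 'cV[R]_du :=
  \sum_(1 <= i < m.+1) blk (N t) i.-1 *m wlag t i omega.

(** The forcing term of the closed loop, x_{t+1} = A_K x_t + drive_t. *)
Definition drive N t omega : 'cV[R]_dx :=
  noise S t omega + sysB S *m dac_noise H N t omega.

Lemma gamma_gt0 : 0 < gamma k. Proof. by case/andP: (ac_gamma hk). Qed.
Lemma gamma_lt1 : gamma k < 1. Proof. by case/andP: (ac_gamma hk). Qed.
Lemma kappa_ge1 : 1 <= kappa k. Proof. exact: ac_kappa hk. Qed.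
Lemma kappa_ge0 : 0 <= kappa k. Proof. exact: le_trans ler01 kappa_ge1. Qed.

Lemma kB_ge0 : 0 <= kB k.
Proof. by case: hn => _ hB _; exact: le_trans (opnorm_ge0 _) hB. Qed.

Lemma noise_le t omega : fnorm (noise S t omega) <= wbar k.
Proof. by case: hn => _ _ [_ _ _ _ [_]]; apply. Qed.

Lemma wbar_ge0 : 0 <= wbar k.
Proof.
have [[omega _]|none] := pselect ([set: Omega S] !=set0).
  exact: le_trans (fnorm_ge0 _) (noise_le 0 omega).
have := @probability_setT _ _ _ (Pr S).
have -> : [set: Omega S] = set0 by apply/eqP/negPn/negP => /set0P.
by rewrite measure0 => /eqP; rewrite eq_sym onee_eq0.
Qed.

Lemma geometric_le n : \sum_(0 <= j < n) (1 - gamma k) ^+ j <= (gamma k)^-1.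
Proof.
rewrite -[leRHS]mul1r ler_pdivlMr ?gamma_gt0 //.
have -> : (\sum_(0 <= j < n) (1 - gamma k) ^+ j) * gamma k = 1 - (1 - gamma k) ^+ n.
  elim: n => [|n IH]; first by rewrite big_nil mul0r expr0 subrr.
  by rewrite big_nat_recr //= mulrDl IH exprS; ring.
by rewrite gerBl exprn_ge0 // subr_ge0 ltW ?gamma_lt1.
Qed.

Lemma geometric_shift_le n : \sum_(1 <= j < n.+1) (1 - gamma k) ^+ j <= (gamma k)^-1.
Proof.
rewrite big_add1 /=; apply: le_trans (geometric_le n); apply: ler_sum => j _.
have h : 0 <= (1 - gamma k) ^+ j by rewrite exprn_ge0 // subr_ge0 ltW ?gamma_lt1.
by rewrite exprS ler_piMl // gerBl ltW ?gamma_gt0.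
Qed.

Lemma geometric_shift_le_nat n : \sum_(1 <= j < n.+1) (1 - gamma k) ^+ j <= n%:R.
Proof.
rewrite big_add1 /= -[n in leRHS]subn0 -[leRHS]mulr1 mulr_natl -sumr_const_nat.
apply: ler_sum => j _; apply: exprn_ile1; last by rewrite gerBl ltW ?gamma_gt0.
by rewrite subr_ge0 ltW ?gamma_lt1.
Qed.

Lemma wlag_le t i omega : fnorm (wlag t i omega) <= wbar k.
Proof. by rewrite /wlag; case: ifP => _; [exact: noise_le | rewrite fnorm0 wbar_ge0]. Qed.

Lemma dac_noise_le m N t omega : (m <= H)%N -> dac_set k (N t) ->
  fnorm (dac_noise m N t omega) <=
  kappa k ^+ 3 * kB k * wbar k * \sum_(1 <= i < m.+1) (1 - gamma k) ^+ i.
Proof.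
move=> mH Nt; apply: le_trans (fnorm_sum _ _ _) _; rewrite mulr_sumr.
rewrite big_nat [leRHS]big_nat; apply: ler_sum => i /andP[i1 im].
have := Nt i; rewrite i1 (leq_trans _ mH) // => /(_ isT) le.
apply: le_trans (opnormP _ _) _; rewrite mulrAC.
by apply: ler_pM; rewrite ?opnorm_ge0 ?fnorm_ge0 ?wlag_le.
Qed.

Let c_ge0 : 0 <= kappa k ^+ 3 * kB k * wbar k.
Proof. by rewrite !mulr_ge0 ?exprn_ge0 ?kappa_ge0 ?kB_ge0 ?wbar_ge0. Qed.

Lemma dac_noise_le_gamma m N t omega : (m <= H)%N -> dac_set k (N t) ->
  fnorm (dac_noise m N t omega) <= kB k * kappa k ^+ 3 * wbar k / gamma k.
Proof.
move=> mH Nt; apply: le_trans (dac_noise_le omega mH Nt) _.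
by rewrite [kB k * _]mulrC ler_wpM2l ?geometric_shift_le.
Qed.

Definition drive_bound : R := wbar k * (1 + H%:R * kB k ^+ 2 * kappa k ^+ 3).

Lemma drive_bound_ge0 : 0 <= drive_bound.
Proof.
rewrite mulr_ge0 ?wbar_ge0 // addr_ge0 ?ler01 // !mulr_ge0 ?exprn_ge0 ?kappa_ge0 ?kB_ge0 //.
Qed.

Lemma drive_le N t omega : dac_set k (N t) -> fnorm (drive N t omega) <= drive_bound.
Proof.
move=> Nt; apply: le_trans (fnormD _ _) _; rewrite /drive_bound mulrDr mulr1.
apply: lerD; first exact: noise_le.
apply: le_trans (opnormP _ _) _.
have hB : opnorm (sysB S) <= kB k by case: hn.
apply: le_trans (ler_pM (opnorm_ge0 _) (fnorm_ge0 _) hB (dac_noise_le omega (leqnn H) Nt)) _.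
have := ler_wpM2l c_ge0 (geometric_shift_le_nat H) => /(ler_wpM2l kB_ge0) h.
by apply: le_trans h _; rewrite le_eqVlt; apply/orP; left; apply/eqP; ring.
Qed.

Lemma stateS N t omega :
  state N t.+1 omega = AK S *m state N t omega + drive N t omega.
Proof.
rewrite /= /dac_input /drive -/(dac_noise H N t omega) mulmxDr mulmxN /AK mulmxBl.
by rewrite !mulmxA -!addrA; congr (_ + (_ + _)); exact: addrC.
Qed.

(** What remains of x_t after unrolling the closed loop h times and forgetting the
    state at time t - h. *)
Definition driven (h : nat) N t omega : 'cV[R]_dx :=
  \sum_(0 <= j < h) AK S ^+ j *m drive N (t.-1 - j) omega.

Lemma state_unroll h N t omega : (h <= t)%N ->
  state N t omega = AK S ^+ h *m state N (t - h) omega + driven h N t omega.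
Proof.
elim: h => [|h IH] ht.
  by rewrite expr0 mul1mx subn0 /driven big_nil addr0.
rewrite IH ?(ltnW ht) // /driven big_nat_recr //= addrCA addrC; congr (_ + _).
  have -> : (t - h = (t - h.+1).+1)%N by lia.
  have -> : (t.-1 - h = t - h.+1)%N by lia.
  by rewrite stateS mulmxDr exprSr -mulmxA.
Qed.

Lemma driven_le h N t omega : (forall s, dac_set k (N s)) ->
  fnorm (driven h N t omega) <= kappa k ^+ 2 * drive_bound / gamma k.
Proof.
move=> hN; apply: le_trans (fnorm_sum _ _ _) _.
apply: (@le_trans _ _ (\sum_(0 <= j < h) kappa k ^+ 2 * drive_bound * (1 - gamma k) ^+ j)).
  apply: ler_sum => j _.
  apply: le_trans (strongly_stable_pow _ _ hs _) _.
    by rewrite !ltW ?gamma_gt0 ?gamma_lt1.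
  rewrite mulrAC ler_wpM2r ?exprn_ge0 ?subr_ge0 ?(ltW gamma_lt1) //.
  by rewrite ler_wpM2l ?exprn_ge0 ?kappa_ge0 // drive_le.
rewrite -mulr_sumr ler_wpM2l ?geometric_le //.
by rewrite mulr_ge0 ?drive_bound_ge0 ?exprn_ge0 ?kappa_ge0.
Qed.

Lemma state_driven N t omega : state N t omega = driven t N t omega.
Proof. by rewrite (state_unroll _ _ (leqnn t)) subnn /= mulmx0 add0r. Qed.

Lemma memory_le t : (memory H t <= H)%N.
Proof. by rewrite /memory; case: ifP; lia. Qed.

Lemma memory_lt t : (0 < t)%N -> (memory H t <= t.-1)%N.
Proof. by rewrite /memory; case: ifP; lia. Qed.

(** Regrouping the double sum that defines the truncated state by the time
    t-1-j at which the parameter acts: for each j the indices i with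
    1 <= i - j <= H are shifted by j, and the part of this range beyond the
    summation bound 2h carries no noise. *)
Lemma ytruncE N t omega : (0 < t)%N ->
  ytrunc N t omega = driven (memory H t).+1 N t omega.
Proof.
move=> t0; rewrite /ytrunc /driven /Psi; set m := memory H t.
have mt : (m <= t.-1)%N by exact: memory_lt.
have mH : (m <= H)%N by exact: memory_le.
under eq_bigr => i _ do rewrite mulmxDl mulmx_suml.
rewrite big_split /=.
under [RHS]eq_bigr => j _ do rewrite /drive mulmxDr.
rewrite [RHS]big_split /=; congr (_ + _).
  rewrite (@big_cat_nat _ _ _ m.+1) //=; last by lia.
  rewrite [X in _ + X]big_nat_cond [X in _ + X]big1 ?addr0; last first.
    by move=> i /andP[/andP[mi _] _]; rewrite leqNgt mi mul0mx.
  rewrite big_nat [RHS]big_nat; apply: eq_bigr => i; rewrite ltnS => /andP[_ im].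
  by rewrite im /wlag (leq_trans im).
rewrite exchange_big /= big_nat [RHS]big_nat; apply: eq_bigr => j /andP[_]; rewrite ltnS => jm.
have jt : (j <= t.-1)%N by exact: leq_trans mt.
pose X i : 'cV[R]_dx := (if (1 <= i - j <= H)%N then AK S ^+ j *m sysB S *m
   blk (N (t.-1 - j)%N) (i - j).-1 else 0) *m wlag t.-1 i omega.
rewrite -/X.
have far i : (2 * m < i)%N -> X i = 0.
  move=> mi; rewrite /X; case: ifP => [/andP[_ ijH]|_]; last by rewrite mul0mx.
  rewrite /wlag; case: ifP => [it|_]; last by rewrite mulmx0.
  move: mi ijH it jm; rewrite /m /memory; case: ifP; lia.
have -> : \sum_(0 <= i < (2 * m).+1) X i = \sum_(0 <= i < (2 * m).+1 + (H + j).+1) X i.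
  rewrite [RHS](@big_cat_nat _ _ _ (2 * m).+1) //= ?leq_addr //.
  rewrite [X in _ = _ + X]big_nat_cond [X in _ = _ + X]big1 ?addr0 //.
  by move=> i /andP[/andP[mi _] _]; exact: far.
rewrite (@big_cat_nat _ _ _ j.+1) //=; last by lia.
rewrite big_nat_cond big1 ?add0r; last first.
  move=> i /andP[/andP[_ ij] _]; rewrite /X.
  have -> : (i - j = 0)%N by lia.
  by rewrite mul0mx.
rewrite (@big_cat_nat _ _ _ (H + j).+1) //=; try lia.
rewrite [X in _ + X]big_nat_cond [X in _ + X]big1 ?addr0; last first.
  move=> i /andP[/andP[Hi _] _]; rewrite /X ifF ?mul0mx //; lia.
rewrite /dac_noise !mulmx_sumr.
rewrite -[j.+1]add1n -[(H + j).+1]addSn big_addn addnK.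
rewrite big_nat [RHS]big_nat; apply: eq_bigr => i /andP[i1 iH].
rewrite /X addnK i1 -ltnS iH !mulmxA; congr (_ *m _).
rewrite /wlag; have -> : (i + j <= t.-1)%N = (i <= t.-1 - j)%N by lia.
by have -> : (t.-1 - (i + j) = t.-1 - j - i)%N by lia.
Qed.

Lemma vtruncE N t omega :
  vtrunc N t omega = - (gainK S *m ytrunc N t omega) + dac_noise (memory H t) N t omega.
Proof. by []. Qed.

Lemma actionE N t omega :
  action N t omega = - (gainK S *m state N t omega) + dac_noise H N t omega.
Proof. by []. Qed.

Lemma state_ytrunc N t omega : (H < t)%N ->
  state N t omega - ytrunc N t omega = AK S ^+ H.+1 *m state N (t - H.+1) omega.
Proof.
move=> Ht; rewrite ytruncE ?(leq_ltn_trans _ Ht) // /memory Ht.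
by rewrite (state_unroll _ _ Ht) addrK.
Qed.

Local Notation D := (radiusD k H).

(** The radius D is what the geometric series give, up to the denominator
    1 - kappa^2 (1-gamma)^(H+1), which lies in (0, 1]. *)
Lemma radius_ge : kappa k ^+ 3 * drive_bound / gamma k + kB k * kappa k ^+ 3 * wbar k / gamma k <= D.
Proof.
rewrite /radiusD lerD2r /drive_bound.
have g0 := gamma_gt0.
have p : 0 <= kappa k ^+ 2 * (1 - gamma k) ^+ H.+1.
  by rewrite mulr_ge0 ?exprn_ge0 ?kappa_ge0 // subr_ge0 ltW ?gamma_lt1.
have -> : kappa k ^+ 3 * (wbar k * (1 + H%:R * kB k ^+ 2 * kappa k ^+ 3)) =
  wbar k * kappa k ^+ 3 * (1 + H%:R * kB k ^+ 2 * kappa k ^+ 3) by ring.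
apply: ler_wpM2l.
  have := drive_bound_ge0; rewrite /drive_bound => h.
  by rewrite mulrAC mulr_ge0 ?exprn_ge0 ?kappa_ge0.
by rewrite lef_pV2 ?posrE ?mulr_gt0 // ger_pMr // gerBl.
Qed.

Let inp_ge0 : 0 <= kB k * kappa k ^+ 3 * wbar k / gamma k.
Proof. by rewrite !mulr_ge0 ?invr_ge0 ?exprn_ge0 ?kappa_ge0 ?kB_ge0 ?wbar_ge0 ?(ltW gamma_gt0). Qed.

Let kD_ge0 : 0 <= kappa k ^+ 2 * drive_bound / gamma k.
Proof. apply: divr_ge0; last exact: ltW gamma_gt0.
by apply: mulr_ge0; [exact/exprn_ge0/kappa_ge0 | exact: drive_bound_ge0]. Qed.

Lemma radius_x : kappa k ^+ 2 * drive_bound / gamma k <= D.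
Proof.
apply: le_trans radius_ge; apply: ler_wpDr; first exact: inp_ge0.
rewrite (_ : kappa k ^+ 3 * drive_bound / gamma k =
  kappa k * (kappa k ^+ 2 * drive_bound / gamma k)); last by ring.
by apply: ler_peMl; [exact: kD_ge0 | exact: kappa_ge1].
Qed.

Lemma radius_ge0 : 0 <= D.
Proof. exact: le_trans radius_x. Qed.

Lemma gainK_le : opnorm (gainK S) <= kappa k.
Proof. by case: hs => Q [L [_ _ _ _ []]]. Qed.

Lemma feedback_le m N t x omega : (m <= H)%N -> dac_set k (N t) ->
  fnorm x <= kappa k ^+ 2 * drive_bound / gamma k ->
  fnorm (- (gainK S *m x) + dac_noise m N t omega) <= D.
Proof.
move=> mH Nt hx; apply: le_trans (fnormD _ _) _; rewrite fnormN.
apply: le_trans radius_ge; apply: lerD; last exact: dac_noise_le_gamma.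
apply: le_trans (opnormP _ _) _.
rewrite (_ : kappa k ^+ 3 * drive_bound / gamma k =
  kappa k * (kappa k ^+ 2 * drive_bound / gamma k)); last by ring.
by apply: ler_pM; rewrite ?opnorm_ge0 ?fnorm_ge0 ?gainK_le.
Qed.

Section bounds.
Context (N : nat -> dac).
Hypothesis hN : forall s, dac_set k (N s).

Lemma state_le t omega : fnorm (state N t omega) <= D.
Proof. by rewrite state_driven; apply: le_trans (driven_le _ _ _ hN) radius_x. Qed.

Lemma ytrunc_le t omega : (0 < t)%N -> fnorm (ytrunc N t omega) <= D.
Proof. by move=> t0; rewrite ytruncE //; apply: le_trans (driven_le _ _ _ hN) radius_x. Qed.

Lemma action_le t omega : fnorm (action N t omega) <= D.
Proof.
by rewrite actionE; apply: feedback_le => //; rewrite state_driven; exact: driven_le.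
Qed.

Lemma vtrunc_le t omega : (0 < t)%N -> fnorm (vtrunc N t omega) <= D.
Proof.
move=> t0; rewrite vtruncE; apply: feedback_le => //; first exact: memory_le.
by rewrite ytruncE //; exact: driven_le.
Qed.

(** Beyond the memory the truncated trajectory forgets only a term damped by
    the (H+1)-st power of the closed loop. *)
Lemma truncation_gap t omega : (H < t)%N ->
  fnorm (state N t omega - ytrunc N t omega)
  + fnorm (action N t omega - vtrunc N t omega)
  <= (1 + kappa k) * (kappa k ^+ 2 * (1 - gamma k) ^+ H.+1 * D).
Proof.
move=> Ht; have e : fnorm (state N t omega - ytrunc N t omega) <=
    kappa k ^+ 2 * (1 - gamma k) ^+ H.+1 * D.
  rewrite state_ytrunc //; apply: le_trans (strongly_stable_pow _ _ hs _) _.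
    by rewrite !ltW ?gamma_gt0 ?gamma_lt1.
  rewrite ler_wpM2l ?state_le // mulr_ge0 ?exprn_ge0 ?kappa_ge0 //.
  by rewrite subr_ge0 ltW ?gamma_lt1.
rewrite mulrDl mul1r; apply: lerD => //.
rewrite actionE vtruncE /memory Ht.
rewrite opprD opprK addrACA subrr addr0 addrC -mulmxBr.
apply: le_trans (opnormP _ _) _; rewrite fnormBC.
by apply: ler_pM; rewrite ?opnorm_ge0 ?fnorm_ge0 ?gainK_le.
Qed.

End bounds.
End trajectories.

(** * Expected costs and truncation *)

Section costs.
Context (R : realType) (dx du : nat) (k : constants R) (S : problem R dx du).
Context (H : nat).
Hypothesis st : standing k S H.

Local Notation dac := (blocks R H du dx).
Implicit Types (N : nat -> dac) (omega : Omega S).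
Local Notation D := (radiusD k H).

Lemma mdot_col p q (A B : 'cV[R]_(p + q)) :
  mdot A B = mdot (usubmx A) (usubmx B) + mdot (dsubmx A) (dsubmx B).
Proof.
rewrite -{1}(vsubmxK A) -{1}(vsubmxK B) /mdot big_split_ord /=.
congr (_ + _); apply: eq_bigr => i _; apply: eq_bigr => j _.
  by rewrite !col_mxEu.
by rewrite !col_mxEd.
Qed.

(** Moving x alone is moving the pair (x, u) in a direction (V, 0). *)
Lemma gradient_usubmx p q (f : 'cV[R]_(p + q) -> R) x u :
  differentiable f (col_mx x u) ->
  gradient (fun x' => f (col_mx x' u)) x = usubmx (gradient f (col_mx x u)).
Proof.
move=> df; apply: gradientP => V.
transitivity ('D_(col_mx V 0) f (col_mx x u)).
  have E : (fun h : R => h^-1 *: (((fun x' => f (col_mx x' u)) \o shift x) (h *: V) - f (col_mx x u))) =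
           (fun h : R => h^-1 *: ((f \o shift (col_mx x u)) (h *: col_mx V 0) - f (col_mx x u))).
    by apply/funext => h /=; rewrite scale_col_mx scaler0 add_col_mx add0r.
  by rewrite /derive E.
by rewrite derive_gradient // mdot_col col_mxKu col_mxKd mdot0r addr0.
Qed.

Lemma gradient_dsubmx p q (f : 'cV[R]_(p + q) -> R) x u :
  differentiable f (col_mx x u) ->
  gradient (fun u' => f (col_mx x u')) u = dsubmx (gradient f (col_mx x u)).
Proof.
move=> df; apply: gradientP => V.
transitivity ('D_(col_mx 0 V) f (col_mx x u)).
  have E : (fun h : R => h^-1 *: (((fun u' => f (col_mx x u')) \o shift u) (h *: V) - f (col_mx x u))) =
           (fun h : R => h^-1 *: ((f \o shift (col_mx x u)) (h *: col_mx 0 V) - f (col_mx x u))).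
    by apply/funext => h /=; rewrite scale_col_mx scaler0 add_col_mx add0r.
  by rewrite /derive E.
by rewrite derive_gradient // mdot_col col_mxKu col_mxKd mdot0r add0r.
Qed.

Lemma mdot_norm_le m n (A B : 'M[R]_(m, n)) : `|mdot A B| <= fnorm A * fnorm B.
Proof.
rewrite ler_norml cauchy_schwarz andbT lerNl -mdotNr -(fnormN B).
exact: cauchy_schwarz.
Qed.

Lemma ball_conv n (x y : 'cV[R]_n) s c : 0 <= s <= 1 -> fnorm x <= c -> fnorm y <= c ->
  fnorm (s *: x + (1 - s) *: y) <= c.
Proof.
move=> /andP[s0 s1] xc yc; apply: le_trans (fnormD _ _) _.
rewrite !fnormZ !ger0_norm ?subr_ge0 //.
have := ler_wpM2l s0 xc; have : (1 - s) * fnorm y <= (1 - s) * c.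
  by rewrite ler_wpM2l // subr_ge0.
lra.
Qed.

(** On the ball of radius D the bounds on the two partial gradients give a
    Lipschitz constant, by the mean value theorem applied jointly. *)
Lemma cost_lipschitz t x u x' u' : cost_assumption k S H t ->
  fnorm x <= D -> fnorm u <= D -> fnorm x' <= D -> fnorm u' <= D ->
  `|cost S t x' u' - cost S t x u| <=
  cG k * D * (fnorm (x' - x) + fnorm (u' - u)).
Proof.
move=> [_ [df _] gb] hx hu hx' hu'.
pose B := [set z : 'cV[R]_(dx + du) | fnorm (usubmx z) <= D /\ fnorm (dsubmx z) <= D].
have cB : convex_on B.
  move=> X Y s [X1 X2] [Y1 Y2] s01; split.
    by have -> : usubmx (s *: X + (1 - s) *: Y) = s *: usubmx X + (1 - s) *: usubmx Y;
      [apply/matrixP => i j; rewrite !mxE | exact: ball_conv].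
  by have -> : dsubmx (s *: X + (1 - s) *: Y) = s *: dsubmx X + (1 - s) *: dsubmx Y;
    [apply/matrixP => i j; rewrite !mxE | exact: ball_conv].
have Bz : B (col_mx x u) by rewrite /B /= col_mxKu col_mxKd.
have Bz' : B (col_mx x' u') by rewrite /B /= col_mxKu col_mxKd.
have one : 0 <= (1 : R) <= 1 by rewrite ler01 lexx.
have [c c01] := mean_value cB Bz Bz' one (fun Z _ => df Z I).
rewrite scale1r mul1r subrKC; set Z := _ + c *: _ => E.
have {E} -> : cost S t x' u' - cost S t x u = mdot (gradient (joint_cost S t) Z) (col_mx x' u' - col_mx x u).
  by rewrite -E /joint_cost !col_mxKu !col_mxKd.
have [BZ1 BZ2] : B Z by exact: convex_segment.
have dZ : differentiable (joint_cost S t) (col_mx (usubmx Z) (dsubmx Z)) by exact: df.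
have [gx gu] := gb _ _ BZ1 BZ2.
have ex : (fun x' => cost S t x' (dsubmx Z)) = (fun x' => joint_cost S t (col_mx x' (dsubmx Z))).
  by apply/funext => a; rewrite /joint_cost col_mxKu col_mxKd.
have eu : (fun u' => cost S t (usubmx Z) u') = (fun u' => joint_cost S t (col_mx (usubmx Z) u')).
  by apply/funext => a; rewrite /joint_cost col_mxKu col_mxKd.
move: gx gu; rewrite ex eu gradient_usubmx // gradient_dsubmx // vsubmxK => gx gu.
rewrite opp_col_mx add_col_mx mdot_col col_mxKu col_mxKd mulrDr.
apply: le_trans (ler_normD _ _) (lerD _ _); apply: le_trans (mdot_norm_le _ _) _;
  by rewrite ler_wpM2r ?fnorm_ge0.
Qed.

Lemma cGD_ge0 t : cost_assumption k S H t -> 0 <= cG k * D.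
Proof.
case=> _ _ /(_ 0 0); rewrite !fnorm0 (radius_ge0 st) => /(_ isT isT) [h _].
exact: le_trans (fnorm_ge0 _) h.
Qed.

Lemma bmeas_cost t (X : Omega S -> 'cV[R]_dx) (U : Omega S -> 'cV[R]_du) :
  cost_assumption k S H t -> vbmeas X -> vbmeas U ->
  (forall omega, fnorm (X omega) <= D) -> (forall omega, fnorm (U omega) <= D) ->
  bmeas (fun omega => cost S t (X omega) (U omega)).
Proof.
move=> hc nX nU bX bU; split.
  have -> : (fun omega => cost S t (X omega) (U omega)) =
      (fun omega => joint_cost S t (col_mx (X omega) (U omega))).
    by apply/funext => omega; rewrite /joint_cost col_mxKu col_mxKd.
  apply: measurable_continuous_comp.
    by move=> z; apply: differentiable_continuous; case: hc => _ [df _] _; exact: df.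
  by move=> i; have [] := vbmeas_col nX nU i ord0.
exists (`|cost S t 0 0| + cG k * D * (D + D)) => omega.
have := cost_lipschitz hc _ _ (bX omega) (bU omega).
move=> /(_ 0 0); rewrite !fnorm0 (radius_ge0 st) !subr0 => /(_ isT isT) h.
rewrite -[cost S t (X omega) _](subrKC (cost S t 0 0)).
apply: le_trans (ler_normD _ _) _; rewrite lerD2l; apply: le_trans h _.
by rewrite ler_wpM2l ?(cGD_ge0 hc) // lerD.
Qed.

Lemma vbmeas_system_noise t : vbmeas (noise S t).
Proof.
case: (st_noise st) => _ _ [mw _ _ _ [_ bw]].
exact: vbmeas_noise.
Qed.

Lemma vbmeas_wlag t i : vbmeas (wlag t i : Omega S -> _).
Proof.
rewrite /wlag; case: (i <= t)%N; last exact: vbmeas_cst.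
exact: vbmeas_system_noise.
Qed.

Lemma vbmeas_dac_noise m N t : vbmeas (dac_noise m N t : Omega S -> _).
Proof. by apply: vbmeas_sum => i _; apply: vbmeas_mulmx; exact: vbmeas_wlag. Qed.

Lemma vbmeas_driven h N t : vbmeas (driven h N t : Omega S -> _).
Proof.
apply: vbmeas_sum => j _; apply: vbmeas_mulmx; apply: vbmeasD.
  exact: vbmeas_system_noise.
by apply: vbmeas_mulmx; exact: vbmeas_dac_noise.
Qed.

Lemma vbmeas_state N t : vbmeas (state N t : Omega S -> _).
Proof.
have -> : (state N t : Omega S -> _) = driven t N t.
  by apply/funext => omega; exact: (state_driven st).
exact: vbmeas_driven.
Qed.

Lemma vbmeas_action N t : vbmeas (action N t : Omega S -> _).
Proof.
apply: vbmeasD; last exact: vbmeas_dac_noise.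
by apply/vbmeasN/vbmeas_mulmx; exact: vbmeas_state.
Qed.

Lemma vbmeas_ytrunc N t : (0 < t)%N -> vbmeas (ytrunc N t : Omega S -> _).
Proof.
move=> t0; have -> : (ytrunc N t : Omega S -> _) = driven (memory H t).+1 N t.
  by apply/funext => omega; exact: (ytruncE st).
exact: vbmeas_driven.
Qed.

Lemma vbmeas_vtrunc N t : (0 < t)%N -> vbmeas (vtrunc N t : Omega S -> _).
Proof.
move=> t0; apply: vbmeasD; last exact: vbmeas_dac_noise.
by apply/vbmeasN/vbmeas_mulmx; exact: vbmeas_ytrunc.
Qed.

Section admissible_parameters.
Context (N : nat -> dac).
Hypothesis hN : forall s, dac_set k (N s).

Lemma bmeas_true_cost t : cost_assumption k S H t ->
  bmeas (fun omega => cost S t (state N t omega) (action N t omega)).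
Proof.
move=> hc; apply: bmeas_cost => //; [exact: vbmeas_state|exact: vbmeas_action| |].
  by move=> omega; exact: (state_le st).
by move=> omega; exact: (action_le st).
Qed.

Lemma bmeas_truncated_cost t : (0 < t)%N -> cost_assumption k S H t ->
  bmeas (fun omega => cost S t (ytrunc N t omega) (vtrunc N t omega)).
Proof.
move=> t0 hc; apply: bmeas_cost => //; [exact: vbmeas_ytrunc|exact: vbmeas_vtrunc| |].
  by move=> omega; exact: (ytrunc_le st).
by move=> omega; exact: (vtrunc_le st).
Qed.

Definition expected_cost t : R :=
  mean (Pr S) (fun omega => cost S t (state N t omega) (action N t omega)).

Lemma loss_expected_cost t b : (0 < t)%N -> cost_assumption k S H t ->
  (forall omega, fnorm (state N t omega - ytrunc N t omega)
     + fnorm (action N t omega - vtrunc N t omega) <= b) ->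
  `|expected_cost t - loss S t N| <= cG k * D * b.
Proof.
move=> t0 hc hb; rewrite /loss -/(mean _ _) -meanB; last 2 first.
- exact: bmeas_true_cost.
- exact: bmeas_truncated_cost.
apply: mean_norm_le.
  by apply: bmeasB; [exact: bmeas_true_cost | exact: bmeas_truncated_cost].
move=> omega; apply: le_trans (_ : cG k * D * _ <= _).
  apply: cost_lipschitz => //; [exact: (ytrunc_le st)|exact: (vtrunc_le st)|exact: (state_le st)|exact: (action_le st)].
by rewrite ler_wpM2l ?(cGD_ge0 hc).
Qed.

Lemma truncation_late t : (H < t)%N -> cost_assumption k S H t ->
  `|expected_cost t - loss S t N| <=
  cG k * D * ((1 + kappa k) * (kappa k ^+ 2 * (1 - gamma k) ^+ H.+1 * D)).
Proof.
move=> Ht hc; apply: loss_expected_cost => //; first by case: t Ht {hc}.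
by move=> omega; exact: (truncation_gap st).
Qed.

(** In the first rounds v_t drops the oldest noise, so the two trajectories may
    differ; the bound uses only that both stay in the ball of radius D. *)
Lemma truncation_early t : (0 < t)%N -> cost_assumption k S H t ->
  `|expected_cost t - loss S t N| <= cG k * D * (4 * D).
Proof.
move=> t0 hc; apply: loss_expected_cost => // omega.
have -> : 4 * D = (D + D) + (D + D) by ring.
by apply: lerD; (apply: le_trans (fnormB _ _) _; apply: lerD);
  [exact: (state_le st)|exact: (ytrunc_le st)|exact: (action_le st)|exact: (vtrunc_le st)].
Qed.

End admissible_parameters.

Lemma expected_regretE T N N' :
  (forall s, dac_set k (N s)) -> (forall s, dac_set k (N' s)) ->
  (forall t, (1 <= t <= T)%N -> cost_assumption k S H t) ->
  expected_regret S T N N' =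
  (\sum_(1 <= t < T.+1) expected_cost N t - \sum_(1 <= t < T.+1) expected_cost N' t)%:E.
Proof.
move=> hN hN' hc; rewrite /expected_regret.
have hb (M : nat -> dac) : (forall s, dac_set k (M s)) -> forall t, (0 < t < T.+1)%N ->
    bmeas (fun omega : Omega S => cost S t (state M t omega) (action M t omega)).
  by move=> hM t tT; apply: bmeas_true_cost => //; exact: hc.
have sumE (M : nat -> dac) omega : \sum_(1 <= t < T.+1) cost S t (state M t omega) (action M t omega) =
    \sum_(1 <= t < T.+1 | (0 < t < T.+1)%N) cost S t (state M t omega) (action M t omega).
  by rewrite big_nat_cond; apply: eq_bigl => t; rewrite andbT.
under eq_fun => omega do rewrite !sumE.
have bs (M : nat -> dac) : (forall s, dac_set k (M s)) -> bmeas (fun omega : Omega S =>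
    \sum_(1 <= t < T.+1 | (0 < t < T.+1)%N) cost S t (state M t omega) (action M t omega)).
  by move=> hM; apply: bmeas_sum => t; exact: hb.
rewrite meanE; last by apply: bmeasB; exact: bs.
rewrite meanB; [|exact: bs|exact: bs].
rewrite !mean_sum; [|exact: hb|exact: hb].
by congr (_ - _)%:E; rewrite [RHS]big_nat_cond; apply: eq_bigl => t; rewrite andbT.
Qed.

End costs.

(** * Parameter sets *)

Section parameter_sets.
Context (R : realType) (dx du : nat) (k : constants R) (H W : nat).
Local Notation dac := (blocks R H du dx).
Local Notation window := (blocks R W (\sum_(i < H) du) dx).

Lemma dac_set_convex : convex_on (@dac_set R dx du k H).
Proof.
move=> X Y s SX SY s01 i iH; rewrite blkD !blkZ.
by apply: opnorm_conv; [|exact: SX|exact: SY].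
Qed.

Lemma window_set_convex : convex_on (@window_set R dx du k H W).
Proof.
move=> X Y s SX SY s01 j jW; rewrite blkD !blkZ.
by apply: dac_set_convex; [exact: SX|exact: SY|].
Qed.

(** With H and dx in place of their square roots, the bound on Frobenius norms is a
    polynomial in H. *)
Definition dac_radius : R := H%:R * dx%:R * (kappa k ^+ 3 * kB k).

Hypothesis k0 : 0 <= kappa k.
Hypothesis b0 : 0 <= kB k.
Hypothesis g01 : 0 <= gamma k <= 1.

Lemma dac_radius_ge0 : 0 <= dac_radius.
Proof. by rewrite !mulr_ge0 ?exprn_ge0. Qed.

Lemma natr_le_sqr (n : nat) : n%:R <= n%:R ^+ 2 :> R.
Proof. by rewrite -natrX ler_nat; case: n => // n; rewrite expnS leq_pmulr ?expn_gt0. Qed.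

Lemma dac_set_bounded (X : dac) : dac_set k X -> fnorm X <= dac_radius.
Proof.
move=> SX; rewrite -(@ler_pXn2r _ 2) ?nnegrE ?fnorm_ge0 ?dac_radius_ge0 //.
rewrite fnorm_blk_sqr.
apply: (@le_trans _ _ (\sum_(0 <= j < H) dx%:R * (kappa k ^+ 3 * kB k) ^+ 2)).
  rewrite big_nat [leRHS]big_nat; apply: ler_sum => j /andP[_ jH].
  apply: le_trans (fnorm_le_opnorm _) _; rewrite ler_wpM2l //.
  rewrite ler_pXn2r ?nnegrE ?opnorm_ge0 ?mulr_ge0 ?exprn_ge0 //.
  apply: le_trans (SX j.+1 _) _; first by rewrite ltnS jH.
  case/andP: g01 => g0 g1.
  rewrite -[leRHS]mulr1 ler_wpM2l ?mulr_ge0 ?exprn_ge0 //.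
  by rewrite exprn_ile1 ?subr_ge0 ?gerBl.
rewrite sumr_const_nat subn0 -[leLHS]mulr_natl /dac_radius !exprMn mulrA ler_wpM2r ?mulr_ge0 ?exprn_ge0 ?sqr_ge0 //.
by rewrite ler_pM ?natr_le_sqr.
Qed.

Lemma dac_set_diameter (X Y : dac) : dac_set k X -> dac_set k Y ->
  fnorm (X - Y) <= 2 * dac_radius.
Proof.
move=> SX SY; apply: le_trans (fnormB _ _) _.
by rewrite mulr_natl mulr2n lerD ?dac_set_bounded.
Qed.

Lemma window_set_diameter (X Y : window) : window_set k X -> window_set k Y ->
  fnorm (X - Y) <= W%:R * (2 * dac_radius).
Proof.
move=> SX SY; have r0 := dac_radius_ge0.
rewrite -(@ler_pXn2r _ 2) ?nnegrE ?fnorm_ge0 ?mulr_ge0 //.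
rewrite fnorm_blk_sqr.
apply: (@le_trans _ _ (\sum_(0 <= j < W) (2 * dac_radius) ^+ 2)).
  rewrite big_nat [leRHS]big_nat; apply: ler_sum => j /andP[_ jW].
  rewrite blkB ler_pXn2r ?nnegrE ?fnorm_ge0 ?mulr_ge0 //.
  exact: dac_set_diameter (SX j jW) (SY j jW).
by rewrite sumr_const_nat subn0 -[leLHS]mulr_natl [in leRHS]exprMn ler_wpM2r ?sqr_ge0 ?natr_le_sqr.
Qed.

Lemma dac_set0 : dac_set k (0 : dac).
Proof.
move=> i _; rewrite blk0 opnorm0 !mulr_ge0 ?exprn_ge0 ?subr_ge0 //.
by case/andP: g01.
Qed.

End parameter_sets.

(** * Surrogate losses and the proximal window step *)

Section surrogates.
Context (R : realType) (dx du : nat) (k : constants R) (S : problem R dx du).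
Context (H : nat).
Hypothesis st : standing k S H.

Local Notation dac := (blocks R H du dx).
Implicit Types (N : nat -> dac) (omega : Omega S).

Lemma dac_noise_affine m (X Y : dac) s t omega :
  dac_noise m (fun=> s *: X + (1 - s) *: Y) t omega =
  s *: dac_noise m (fun=> X) t omega + (1 - s) *: dac_noise m (fun=> Y) t omega.
Proof.
rewrite /dac_noise !scaler_sumr -big_split; apply: eq_bigr => i _ /=.
by rewrite blkD !blkZ mulmxDl -!scalemxAl.
Qed.

Lemma dac_noiseB m (X Y : dac) t omega :
  dac_noise m (fun=> X - Y) t omega =
  dac_noise m (fun=> X) t omega - dac_noise m (fun=> Y) t omega.
Proof.
rewrite /dac_noise -sumrB; apply: eq_bigr => i _.
by rewrite blkB mulmxBl.
Qed.

Lemma driven_affine h (X Y : dac) s t omega :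
  driven h (fun=> s *: X + (1 - s) *: Y) t omega =
  s *: driven h (fun=> X) t omega + (1 - s) *: driven h (fun=> Y) t omega.
Proof.
rewrite /driven !scaler_sumr -big_split; apply: eq_bigr => j _ /=.
rewrite !scalemxAr -mulmxDr; congr (_ *m _).
rewrite /drive dac_noise_affine mulmxDr -!scalemxAr !scalerDr addrACA -scalerDl.
by rewrite subrKC scale1r.
Qed.

Lemma ytrunc_affine (X Y : dac) s t omega : (0 < t)%N ->
  ytrunc (fun=> s *: X + (1 - s) *: Y) t omega =
  s *: ytrunc (fun=> X) t omega + (1 - s) *: ytrunc (fun=> Y) t omega.
Proof. by move=> t0; rewrite !(ytruncE st) // driven_affine. Qed.

Lemma vtrunc_affine (X Y : dac) s t omega : (0 < t)%N ->
  vtrunc (fun=> s *: X + (1 - s) *: Y) t omega =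
  s *: vtrunc (fun=> X) t omega + (1 - s) *: vtrunc (fun=> Y) t omega.
Proof.
move=> t0; rewrite !vtruncE ytrunc_affine // dac_noise_affine mulmxDr -!scalemxAr.
by rewrite !scalerDr !scalerN opprD addrACA.
Qed.

Lemma dac_noise_energy (X : dac) t : (H < t)%N ->
  sigma k ^+ 2 * fnorm X ^+ 2 <=
  mean (Pr S) (fun omega => fnorm (dac_noise H (fun=> X) t omega) ^+ 2).
Proof.
move=> Ht; case: (st_noise st) => _ _ [mw iw _ w0 [cw bw]].
have inj : injective (fun i : 'I_H => (t - i.+1)%N).
  move=> i j /= e; apply: val_inj => /=.
  by have := ltn_ord i; have := ltn_ord j; lia.
have := noise_energy mw iw w0 cw bw (fun i : 'I_H => blk X i) inj.
rewrite fnorm_blk_sqr big_mkord; congr (_ <= mean _ _).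
apply/funext => omega; rewrite /dac_noise big_add1 /= big_mkord.
congr (fnorm _ ^+ 2); apply: eq_bigr => i _; rewrite /wlag ifT //.
exact: leq_trans (ltn_ord i) (ltnW Ht).
Qed.

(** The factor 1 + kappa^2 comes from |v + K y|^2 <= (1 + kappa^2)(|y|^2 + |v|^2). *)
Definition modulus : R := alpha k * sigma k ^+ 2 / (1 + kappa k ^+ 2).

Lemma feedback_energy (y : 'cV[R]_dx) (v : 'cV[R]_du) :
  fnorm (v + gainK S *m y) ^+ 2 / (1 + kappa k ^+ 2) <= fnorm y ^+ 2 + fnorm v ^+ 2.
Proof.
have k1 : 0 < 1 + kappa k ^+ 2 by rewrite ltr_wpDr ?sqr_ge0.
rewrite ler_pdivrMr //.
have le : fnorm (v + gainK S *m y) <= fnorm v + kappa k * fnorm y.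
  apply: le_trans (fnormD _ _) _; rewrite lerD2l; apply: le_trans (opnormP _ _) _.
  by rewrite ler_wpM2r ?fnorm_ge0 ?(gainK_le st).
have kap := kappa_ge0 st.
have : fnorm (v + gainK S *m y) ^+ 2 <= (fnorm v + kappa k * fnorm y) ^+ 2.
  by rewrite ler_pXn2r ?nnegrE ?fnorm_ge0 ?addr_ge0 ?mulr_ge0 ?fnorm_ge0.
move/le_trans; apply.
have := sqr_ge0 (kappa k * fnorm v - fnorm y).
lra.
Qed.

(** The truncated state and action are affine in M, and v + K y does not involve
    the closed-loop dynamics: it is the sum of the M^[i-1] w_{t-i}.  For t > H all
    the H blocks meet a genuine noise, so that its energy controls |M|^2. *)
Lemma surrogate_strongly_convex t : (H < t)%N -> cost_assumption k S H t ->
  strongly_convex_on (@dac_set R dx du k H) modulus (surrogate S t).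
Proof.
move=> Ht hc X Y s SX SY s01.
have t0 : (0 < t)%N by exact: leq_ltn_trans Ht.
have SZ : dac_set k (s *: X + (1 - s) *: Y) by exact: dac_set_convex.
have hcst (Z : dac) : dac_set k Z -> forall r : nat, dac_set k ((fun=> Z) r) by [].
pose f (Z : dac) omega := cost S t (ytrunc (fun=> Z) t omega) (vtrunc (fun=> Z) t omega).
have bf Z : dac_set k Z -> bmeas (f Z).
  by move=> SZ'; apply: (bmeas_truncated_cost st (hcst _ SZ') t0 hc).
pose e omega := fnorm (dac_noise H (fun=> X - Y) t omega) ^+ 2.
have be : bmeas e.
  have -> : e = (fun omega => mdot (dac_noise H (fun=> X - Y) t omega)
      (dac_noise H (fun=> X - Y) t omega)).
    by apply/funext => omega; rewrite /e fnorm_sqr.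
  by apply: bmeas_mdot; exact: (vbmeas_dac_noise st).
pose c := alpha k / 2 * s * (1 - s) / (1 + kappa k ^+ 2).
have c0 : 0 <= c.
  case/andP: s01 => s0 s1; have a0 := ac_alpha (st_const st).
  by rewrite /c !mulr_ge0 ?invr_ge0 ?subr_ge0 ?addr_ge0 ?sqr_ge0 // ltW.
have pt omega : f (s *: X + (1 - s) *: Y) omega <=
    s * f X omega + (1 - s) * f Y omega - c * e omega.
  case: hc => sc _ _.
  have := sc (col_mx (ytrunc (fun=> X) t omega) (vtrunc (fun=> X) t omega))
    (col_mx (ytrunc (fun=> Y) t omega) (vtrunc (fun=> Y) t omega)) s I I s01.
  rewrite !scale_col_mx add_col_mx -ytrunc_affine // -vtrunc_affine //.
  rewrite /joint_cost !col_mxKu !col_mxKd => /le_trans; apply.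
  rewrite /f lerD2l lerN2 opp_col_mx add_col_mx fnorm_colmx /c.
  rewrite -mulrA [_ * e _]mulrC ler_wpM2l //.
    case/andP: s01 => s0 s1; have a0 := ac_alpha (st_const st).
    by rewrite !mulr_ge0 ?subr_ge0 // ltW.
  have -> : e omega = fnorm ((vtrunc (fun=> X) t omega - vtrunc (fun=> Y) t omega)
     + gainK S *m (ytrunc (fun=> X) t omega - ytrunc (fun=> Y) t omega)) ^+ 2.
    congr (fnorm _ ^+ 2); rewrite !vtruncE /memory Ht mulmxBr.
    have E (a b x y : 'cV[R]_du) : a - b = - x + a - (- y + b) + (x - y).
      by apply/matrixP => i j; rewrite !mxE; ring.
    by rewrite dac_noiseB; exact: E.
  exact: feedback_energy.
have le1 : mean (Pr S) (f (s *: X + (1 - s) *: Y)) <=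
    mean (Pr S) (fun omega => s * f X omega + (1 - s) * f Y omega - c * e omega).
  apply: le_mean => //; first exact: bf.
  by apply: bmeasB; [apply: bmeasD; apply: bmeasZ; exact: bf | exact: bmeasZ].
rewrite meanB ?meanD ?meanZ in le1; try (by exact: bf); try (by exact: bmeasZ);
  try (by apply: bmeasZ; exact: bf);
  try (by apply: bmeasD; apply: bmeasZ; exact: bf); last exact: be.
apply: le_trans le1 _; rewrite lerD2l lerN2.
have := ler_wpM2l c0 (dac_noise_energy (X - Y) Ht); apply: le_trans.
by rewrite /c /modulus le_eqVlt; apply/orP; left; apply/eqP; ring.
Qed.

Lemma mu_lt_modulus : mu k < modulus.
Proof.
have a0 := ac_alpha (st_const st); have s0 := ac_sigma (st_const st).
have g0 := gamma_gt0 st; have g1 := gamma_lt1 st; have k1 := kappa_ge1 st.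
have kk : 1 <= kappa k ^+ 2 by rewrite exprn_ege1.
have k10 : kappa k ^+ 2 <= kappa k ^+ 10 by rewrite ler_weXn2l.
have gg : gamma k ^+ 2 <= 1 by rewrite exprn_ile1 // ltW.
have p1 : 0 < 36 * kappa k ^+ 10 by rewrite mulr_gt0 // exprn_gt0 // (lt_le_trans ltr01).
have p2 : 0 < 1 + kappa k ^+ 2 by rewrite ltr_wpDr ?sqr_ge0.
have q : gamma k ^+ 2 / (36 * kappa k ^+ 10) < (1 + kappa k ^+ 2)^-1.
  rewrite ltr_pdivrMr // mulrC ltr_pdivlMr //.
  apply: (@le_lt_trans _ _ (1 * (1 + kappa k ^+ 2))); last by lra.
  by rewrite ler_wpM2r // ltW.
have -> : mu k = alpha k * sigma k ^+ 2 * (gamma k ^+ 2 / (36 * kappa k ^+ 10)).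
  by rewrite /mu; ring.
by rewrite /modulus ltr_pM2l // mulr_gt0 ?exprn_gt0.
Qed.

Lemma loss_local t N N' : (0 < t)%N ->
  (forall s, (t.-1 - H <= s <= t)%N -> N s = N' s) -> loss S t N = loss S t N'.
Proof.
move=> t0 e; rewrite /loss; congr fine; congr expectation; apply/funext => omega.
have eN m s : (t.-1 - H <= s <= t)%N -> dac_noise m N s omega = dac_noise m N' s omega.
  by move=> hs; rewrite /dac_noise e.
have ey : ytrunc N t omega = ytrunc N' t omega.
  rewrite !(ytruncE st) // /driven big_nat [RHS]big_nat; apply: eq_bigr => j /andP[_ jm].
  rewrite /drive eN //; move: (memory_le st t); lia.
by rewrite !vtruncE ey eN // leqnn andbT; lia.
Qed.

Section lipschitz.
Context (c : R) (t : nat).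
Hypothesis t0 : (0 < t)%N.
Hypothesis lip : coord_lipschitz k S H c t.

(** Exchange the arguments one at a time; only the H+2 most recent ones enter
    the loss. *)
Lemma loss_lipschitz N N' :
  (forall s, dac_set k (N s)) -> (forall s, dac_set k (N' s)) ->
  `|loss S t N - loss S t N'| <=
  c * \sum_(t.-1 - H <= s < t.+1) fnorm (N s - N' s).
Proof.
move=> hN hN'.
pose h a s := if (s < a)%N then N' s else N s.
have hh a s : dac_set k (h a s) by rewrite /h; case: ifP.
have -> : loss S t N = loss S t (h (t.-1 - H)%N).
  by apply: loss_local => // s /andP[s1 _]; rewrite /h ltnNge s1.
have -> : loss S t N' = loss S t (h t.+1).
  by apply: loss_local => // s /andP[_ s1]; rewrite /h ltnS s1.
rewrite distrC -(telescope_sumr (fun a => loss S t (h a))); last by lia.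
rewrite mulr_sumr; apply: le_trans (ler_norm_sum _ _ _) _; apply: ler_sum => a _.
rewrite distrC; have := lip (hh a) (hh a.+1) (j := a).
have -> : h a a = N a by rewrite /h ltnn.
have -> : h a.+1 a = N' a by rewrite /h ltnSn.
apply=> s sa.
by rewrite /h ltnS [(s <= a)%N]leq_eqVlt (negPf sa).
Qed.

Hypothesis c0 : 0 <= c.

Lemma window_count : (t.+1 - (t.-1 - H) <= H.+2)%N.
Proof. lia. Qed.

Lemma surrogate_lipschitz (X Y : dac) : dac_set k X -> dac_set k Y ->
  `|surrogate S t X - surrogate S t Y| <= c * H.+2%:R * fnorm (X - Y).
Proof.
move=> SX SY; apply: le_trans (@loss_lipschitz (fun=> X) (fun=> Y) _ _) _ => //.
rewrite -mulrA ler_wpM2l // sumr_const_nat -[leLHS]mulr_natl ler_wpM2r ?fnorm_ge0 //.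
by rewrite ler_nat window_count.
Qed.

(** For s between t-1-H and t, the distance from N_s to N_t is at most the sum of
    the last H+1 moves. *)
Lemma loss_surrogate N : (forall s, dac_set k (N s)) ->
  `|loss S t N - surrogate S t (N t)| <=
  c * (H.+2%:R * \sum_(0 <= i < H.+1) fnorm (N (t - i)%N - N (t - i).-1)).
Proof.
move=> hN; apply: le_trans (@loss_lipschitz N (fun=> N t) _ _) _ => //.
rewrite ler_wpM2l //; set V := \sum_(0 <= i < H.+1) _.
have V0 : 0 <= V by apply: sumr_ge0 => i _; exact: fnorm_ge0.
apply: (@le_trans _ _ (\sum_(t.-1 - H <= s < t.+1) V)); last first.
  rewrite sumr_const_nat -[leLHS]mulr_natl ler_wpM2r //.
  by rewrite ler_nat window_count.
rewrite big_nat [leRHS]big_nat; apply: ler_sum => s /andP[s1 s2].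
have main n : (n <= H.+1)%N -> fnorm (N (t - n)%N - N t) <=
    \sum_(0 <= i < n) fnorm (N (t - i)%N - N (t - i).-1).
  elim: n => [|n IH] nH; first by rewrite subn0 subrr fnorm0 big_nil.
  rewrite big_nat_recr //= addrC; apply: le_trans (fnorm_triangle _ (N (t - n)%N) _) _.
  by apply: lerD; [rewrite subnS fnormBC | exact/IH/ltnW].
have := main (t - s)%N; rewrite subKn //.
move=> /(_ _) /le_trans; apply; first by move: s1; lia.
rewrite /V [leRHS](@big_cat_nat _ _ _ (t - s)) //=; last by move: s1; lia.
by rewrite lerDl sumr_ge0 // => i _; exact: fnorm_ge0.
Qed.

End lipschitz.

Lemma path_length_ge0 N T : 0 <= path_length N T.
Proof. by apply: sumr_ge0 => t _; exact: fnorm_ge0. Qed.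

(** The index t - i is truncated at 0, where N_0 - N_(0.-1) = 0 contributes
    nothing. *)
Lemma path_length_shift N T i :
  \sum_(1 <= t < T.+1) fnorm (N (t - i)%N - N (t - i).-1) <= path_length N T.
Proof.
have step U : path_length N U <= path_length N U.+1.
  by rewrite /path_length [leRHS]big_nat_recr //= lerDl fnorm_ge0.
elim: i T => [|i IH] T.
  by rewrite /path_length; under eq_bigr do rewrite subn0.
rewrite big_add1 /=; under eq_bigr do rewrite subSS.
case: T => [|T]; first by rewrite big_nil path_length_ge0.
rewrite big_ltn // sub0n subrr fnorm0 add0r.
exact: le_trans (IH T) (step T).
Qed.

(** Evaluating f_t at the recent past instead of at H+2 copies of N_t costs at
    most lambda times the path length: this is what fixes lambda. *)
Lemma total_loss_surrogate c N T : 0 <= c ->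
  (forall t, (1 <= t <= T)%N -> coord_lipschitz k S H c t) ->
  (forall s, dac_set k (N s)) ->
  `|\sum_(1 <= t < T.+1) loss S t N - \sum_(1 <= t < T.+1) surrogate S t (N t)| <=
  H.+2%:R ^+ 2 * c * path_length N T.
Proof.
move=> c0 lip hN; rewrite -sumrB; apply: le_trans (ler_norm_sum _ _ _) _.
apply: (@le_trans _ _ (\sum_(1 <= t < T.+1) c * (H.+2%:R *
    \sum_(0 <= i < H.+1) fnorm (N (t - i)%N - N (t - i).-1)))).
  rewrite big_nat [leRHS]big_nat; apply: ler_sum => t /andP[t1 tT].
  by apply: loss_surrogate => //; apply: lip; rewrite t1.
rewrite -!mulr_sumr exchange_big /=.
apply: (@le_trans _ _ (c * (H.+2%:R * \sum_(0 <= i < H.+1) path_length N T))).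
  rewrite !ler_wpM2l //; apply: ler_sum => i _; exact: path_length_shift.
rewrite sumr_const_nat subn0 -[X in c * (_ * X)]mulr_natl.
rewrite (_ : _ ^+ 2 * _ * _ = c * (H.+2%:R * (H.+2%:R * path_length N T))); last by ring.
by rewrite !ler_wpM2l // ler_wpM2r ?path_length_ge0 // ler_nat.
Qed.

Section window_contraction.
Context (W : nat) (L lam : R) (t : nat).
Local Notation window := (blocks R W (\sum_(i < H) du) dx).
Hypothesis Ht : (H < t)%N.
Hypothesis hc : forall j, (j < W)%N -> cost_assumption k S H (t + j).
Hypothesis hL : forall j, (j < W)%N ->
  smooth_on (@dac_set R dx du k H) L (surrogate S (t + j) (H := H)).
Hypothesis lam0 : 0 <= lam.
Hypothesis etaL : L * eta k <= 1.

Lemma Fwin_gradient (Y V : window) : window_set k Y ->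
  mdot (gradient (Fwin S t (H := H)) Y) V =
  \sum_(0 <= j < W) mdot (gradient (surrogate S (t + j) (H := H)) (blk Y j)) (blk V j).
Proof.
move=> SY; apply: (@gradient_separable R W (\sum_(i < H) du) dx (fun j => surrogate S (t + j) (H := H))).
by move=> j jW; have [df _] := hL jW; apply/df/SY.
Qed.

Lemma Fwin_tangent (X Y : window) : window_set k X -> window_set k Y ->
  Fwin S t X + mdot (gradient (Fwin S t (H := H)) X) (Y - X)
    + modulus / 2 * fnorm (Y - X) ^+ 2 <= Fwin S t Y.
Proof.
move=> SX SY; rewrite Fwin_gradient // fnorm_blk_sqr mulr_sumr /Fwin -!big_split /=.
rewrite big_nat [leRHS]big_nat; apply: ler_sum => j /andP[_ jW]; rewrite blkB.
apply: (strong_convexity_tangent (@dac_set_convex _ _ _ _ _) (SX j jW) (SY j jW) (hL jW)).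
apply: surrogate_strongly_convex; last exact: hc.
exact: leq_trans Ht (leq_addr _ _).
Qed.

Lemma Fwin_descent (X Y : window) : window_set k X -> window_set k Y ->
  Fwin S t Y <= Fwin S t X + mdot (gradient (Fwin S t (H := H)) X) (Y - X)
    + L / 2 * fnorm (Y - X) ^+ 2.
Proof.
move=> SX SY; rewrite Fwin_gradient // fnorm_blk_sqr mulr_sumr /Fwin -!big_split /=.
rewrite big_nat [leRHS]big_nat; apply: ler_sum => j /andP[_ jW]; rewrite blkB.
exact: (descent (@dac_set_convex _ _ _ _ _) (SX j jW) (SY j jW) (hL jW)).
Qed.

Lemma Rwin_convex (prev next : dac) :
  strongly_convex_on (@window_set R dx du k H W) 0 (Rwin lam prev next).
Proof.
move=> X Y s _ _ s01; have [s0 s1] := andP s01.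
rewrite !mul0r subr0 /Rwin.
have tri (A B C D : dac) : fnorm (s *: A + (1 - s) *: B - (s *: C + (1 - s) *: D)) <=
    s * fnorm (A - C) + (1 - s) * fnorm (B - D).
  rewrite opprD addrACA -!scalerBr; apply: le_trans (fnormD _ _) _.
  by rewrite !fnormZ !ger0_norm ?subr_ge0.
have wp j : wprev prev (s *: X + (1 - s) *: Y) j =
    s *: wprev prev X j + (1 - s) *: wprev prev Y j.
  case: j => [|j] /=; last by rewrite blkD !blkZ.
  by rewrite -scalerDl subrKC scale1r.
have e1 : \sum_(0 <= j < W) fnorm (blk (s *: X + (1 - s) *: Y) j - wprev prev (s *: X + (1 - s) *: Y) j)
  <= s * (\sum_(0 <= j < W) fnorm (blk X j - wprev prev X j)) +
     (1 - s) * (\sum_(0 <= j < W) fnorm (blk Y j - wprev prev Y j)).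
  rewrite !mulr_sumr -big_split /=; apply: ler_sum => j _.
  by rewrite wp blkD !blkZ; exact: tri.
have e2 : fnorm (next - wprev prev (s *: X + (1 - s) *: Y) W) <=
  s * fnorm (next - wprev prev X W) + (1 - s) * fnorm (next - wprev prev Y W).
  have nE : next = s *: next + (1 - s) *: next by rewrite -scalerDl subrKC scale1r.
  by rewrite wp [in leLHS]nE; exact: tri.
have := ler_wpM2l lam0 e1; have := ler_wpM2l lam0 e2; lra.
Qed.

Lemma window_step (prev next : dac) (Y Z Zs : window) :
  window_set k Y ->
  is_argmin (@window_set R dx du k H W) (prox_objective k S lam t prev next Y) Z ->
  is_local_minimizer k S lam t prev next Zs ->
  fnorm (Z - Zs) ^+ 2 <= (1 - modulus * eta k) * fnorm (Y - Zs) ^+ 2.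
Proof.
move=> SY mZ mZs.
exact: (prox_contraction (@window_set_convex _ _ _ _ _ _) (@Rwin_convex prev next)
  (ac_eta (st_const st)) etaL Fwin_tangent Fwin_descent SY mZ mZs).
Qed.

Hypothesis mu1 : mu k * eta k <= 1.

(** The step factor 1 - modulus eta is at most rho^2 because mu is below the
    modulus. *)
Lemma window_iterates (prev next : dac) (Z : nat -> window) Zs :
  window_set k (Z 0%N) ->
  (forall i, (1 <= i <= W)%N ->
     is_argmin (@window_set R dx du k H W) (prox_objective k S lam t prev next (Z i.-1)) (Z i)) ->
  is_local_minimizer k S lam t prev next Zs ->
  forall i, (i <= W)%N -> fnorm (Z i - Zs) <= rho k ^+ i * fnorm (Z 0%N - Zs).
Proof.
move=> S0 mZ mZs; have SZ i : (i <= W)%N -> window_set k (Z i).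
  by case: i => [_|i iW]; [exact: S0 | exact: (mZ i.+1 iW).1].
elim=> [|i IH] iW; first by rewrite expr0 mul1r.
have r2 : rho k ^+ 2 = 1 - mu k * eta k by rewrite sqr_sqrtr ?subr_ge0.
have r0 : 0 <= rho k by exact: sqrtr_ge0.
rewrite exprS -mulrA; apply: (@le_trans _ _ (rho k * fnorm (Z i - Zs))); last first.
  by rewrite ler_wpM2l // IH // ltnW.
rewrite -(@ler_pXn2r _ 2) ?nnegrE ?mulr_ge0 ?fnorm_ge0 // exprMn r2.
apply: le_trans (window_step (SZ _ (ltnW iW)) (mZ i.+1 iW) mZs) _.
rewrite ler_wpM2r ?sqr_ge0 // lerD2l lerN2 ler_wpM2r ?ltW ?mu_lt_modulus //.
exact: ac_eta (st_const st).
Qed.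

End window_contraction.

(** The tangent bound and the descent bound sandwich the surrogate at two distinct
    points. *)
Lemma modulus_le_smooth L t (X Y : dac) : (H < t)%N -> cost_assumption k S H t ->
  smooth_on (@dac_set R dx du k H) L (surrogate S t (H := H)) ->
  dac_set k X -> dac_set k Y -> X != Y -> modulus <= L.
Proof.
move=> Ht hc hL SX SY XY.
have h1 := strong_convexity_tangent (@dac_set_convex _ _ _ _ _) SX SY hL
  (surrogate_strongly_convex Ht hc).
have h2 := descent (@dac_set_convex _ _ _ _ _) SX SY hL.
have p : 0 < fnorm (Y - X) ^+ 2.
  by rewrite exprn_gt0 // lt_neqAle fnorm_ge0 eq_sym fnorm_eq0 subr_eq0 eq_sym XY.
have := le_trans h1 h2; rewrite lerD2l ler_pM2r //; lra.
Qed.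

End surrogates.

(** * Causality *)

Section locality.
Context (R : realType) (dx du : nat) (S : problem R dx du) (H : nat).
Implicit Types N : nat -> blocks R H du dx.

Lemma state_local N N' t (omega : Omega S) :
  (forall s, (s < t)%N -> N s = N' s) -> state N t omega = state N' t omega.
Proof.
elim: t => [//|t IH] e /=; rewrite IH => [|s st]; last exact/e/ltnW.
by rewrite /dac_input e.
Qed.

Lemma action_local N N' t (omega : Omega S) :
  (forall s, (s <= t)%N -> N s = N' s) -> action N t omega = action N' t omega.
Proof.
move=> e; rewrite /action /dac_input e // (@state_local N N') // => s st.
exact/e/ltnW.
Qed.

Lemma expected_regret_local T N N' M M' :
  (forall s, (s <= T)%N -> N s = N' s) -> (forall s, (s <= T)%N -> M s = M' s) ->
  expected_regret S T N M = expected_regret S T N' M'.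
Proof.
have same (A A' : nat -> blocks R H du dx) (omega : Omega S) : (forall s, (s <= T)%N -> A s = A' s) ->
    \sum_(1 <= t < T.+1) cost S t (state A t omega) (action A t omega) =
    \sum_(1 <= t < T.+1) cost S t (state A' t omega) (action A' t omega).
  move=> e; rewrite big_nat [RHS]big_nat; apply: eq_bigr => t /andP[_ tT].
  rewrite (@state_local A A') => [|s st]; last by apply: e; lia.
  by rewrite (@action_local A A') // => s st; apply: e; lia.
move=> e e'; rewrite /expected_regret; congr expectation; apply/funext => omega.
by rewrite (same N N') // (same M M').
Qed.

Lemma expected_regret_same T N M :
  (forall s, (s <= T)%N -> N s = M s) -> expected_regret S T N M = 0%E.
Proof.
move=> e; rewrite (@expected_regret_local T N M M M) // /expected_regret.
by under eq_fun do rewrite subrr; rewrite expectation_cst.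
Qed.

Lemma gRH_local lam T N N' : (forall s, (s <= T)%N -> N s = N' s) ->
  gRH S lam T N = gRH S lam T N'.
Proof.
move=> e; rewrite /gRH /path_length; congr (_ + _ * _);
  rewrite big_nat [RHS]big_nat; apply: eq_bigr => t /andP[_ tT]; rewrite !e //; lia.
Qed.

Lemma path_length_local T N N' : (forall s, (s <= T)%N -> N s = N' s) ->
  path_length N T = path_length N' T.
Proof.
move=> e; rewrite /path_length.
by rewrite big_nat [RHS]big_nat; apply: eq_bigr => t /andP[_ tT]; rewrite !e //; lia.
Qed.

End locality.

(** * The regret bound for fixed T *)

(** Serves twice: the truncation and the optimization errors are small only after
    the first H rounds. *)
Lemma early_sum (R : realType) (H T : nat) (a b : R) (F : nat -> R) : 0 <= a -> 0 <= b ->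
  (forall t, (1 <= t <= T)%N -> F t <= (if (t <= H)%N then a else 0) + b) ->
  \sum_(1 <= t < T.+1) F t <= H%:R * a + T%:R * b.
Proof.
move=> a0 b0 h.
apply: (@le_trans _ _ (\sum_(1 <= t < T.+1) ((if (t <= H)%N then a else 0) + b))).
  by rewrite big_nat [leRHS]big_nat; apply: ler_sum => t tT; exact: h.
rewrite big_split /= sumr_const_nat subSS subn0 -[X in _ + X <= _]mulr_natl lerD2r.
apply: (@le_trans _ _ ((minn T H)%:R * a)); last first.
  by rewrite ler_wpM2r // ler_nat geq_minr.
elim: T {h} => [|T IH]; first by rewrite big_nil min0n mul0r.
rewrite big_nat_recr //=; case: ifP => TH.
  have -> : minn T.+1 H = (minn T H).+1 by lia.
  by rewrite mulrS mulrDl mul1r addrC lerD2l.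
have -> : minn T.+1 H = minn T H by lia.
by rewrite addr0.
Qed.

Lemma window_index (T W t j : nat) : (1 <= t <= T)%N -> (j < W)%N ->
  (1 <= t + j <= (T + W).-1)%N.
Proof. lia. Qed.

Section regret.
Context (R : realType) (dx du : nat) (k : constants R) (T H W : nat).
Context (S : problem R dx du) (r : run R dx du H W).
Hypothesis hk : admissible_constants k.
Hypothesis ps : poc_setting k T S r.

Local Notation dac := (blocks R H du dx).

Lemma comparator_dac s : (s <= T)%N -> dac_set k (comparator r s).
Proof.
have [c0 cT] := ps_comp ps.
by case: s => [_|s sT]; [rewrite c0; exact: ps_init ps | exact: cT].
Qed.

Lemma minRH_dac s : (s <= T)%N -> dac_set k (minRH r s).
Proof.
have [[c0 cT] _] := ps_minRH ps.
by case: s => [_|s sT]; [rewrite c0; exact: ps_init ps | exact: cT].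
Qed.

Lemma ogd_dac s : (1 <= s <= (T + W).-1.+1)%N -> dac_set k (ogd r s).
Proof.
have [[g1 gS] _ _] := ps_poc ps.
case: s => [|[|s]] sT //; first by rewrite g1; exact: ps_init ps.
by have [] := gS s.+1 sT.
Qed.

Let k0 : 0 <= kappa k. Proof. exact: le_trans ler01 (ac_kappa hk). Qed.
Let b0 : 0 <= kB k.
Proof. by case: (ps_noise ps) => _ hB _; exact: le_trans (opnorm_ge0 _) hB. Qed.
Let g01 : 0 <= gamma k <= 1.
Proof. by case/andP: (ac_gamma hk) => g0 g1; rewrite !ltW. Qed.

(** For W = 0 the executed parameter is the default block 0, which is admissible. *)
Lemma executed_dac s : (s <= T)%N -> dac_set k (executed r s).
Proof.
have [_ e0 eT] := ps_poc ps.
case: s => [_|s sT]; first by rewrite e0; exact: ps_init ps.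
have [Z [_ mZ ->]] := eT s.+1 sT.
have [W0|W1] := leqP W 0; first by rewrite blk_out //; exact: dac_set0.
by have [SZ _] := mZ W (introT andP (conj W1 (leqnn W))); exact: SZ.
Qed.

Lemma regret_trivial : (forall X Y : dac, dac_set k X -> dac_set k Y -> X = Y) ->
  expected_regret S T (executed r) (comparator r) = 0%E.
Proof.
move=> triv; apply: expected_regret_same => s sT.
by apply: triv; [exact: executed_dac | exact: comparator_dac].
Qed.

Hypothesis st : standing k S H.
Hypothesis T0 : (0 < T)%N.
Hypothesis W0 : (0 < W)%N.
Hypothesis hHT : (H < (T + W).-1)%N.
Context (X Y : dac).
Hypothesis SX : dac_set k X.
Hypothesis SY : dac_set k Y.
Hypothesis XY : X != Y.

Local Notation D := (radiusD k H).
Local Notation c := (Lf r).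
Local Notation lam := (lambda r).

Let SN : (1 <= H.+1 <= (T + W).-1)%N. Proof. exact: hHT. Qed.

Let inT t : (1 <= t <= T)%N -> (1 <= t <= (T + W).-1)%N.
Proof. lia. Qed.

(** The constant L_f is only an upper bound for differences of losses; two distinct
    parameters force it to be nonnegative. *)
Lemma Lf_ge0 : 0 <= c.
Proof.
have := ps_Lf ps SN (N := fun=> X) (N' := fun s => if s == 0%N then Y else X) (j := 0%N).
move=> /(_ (fun=> SX)) h.
have := h (fun s => _); rewrite eqxx => {}h.
have p : 0 < fnorm (X - Y) by rewrite lt_neqAle fnorm_ge0 eq_sym fnorm_eq0 subr_eq0 XY.
rewrite -(pmulr_lge0 _ p); apply: le_trans (h _ _); rewrite ?normr_ge0 //.
  by move=> s; case: ifP.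
by move=> s /negPf ->.
Qed.

Lemma lambda_ge0 : 0 <= lam.
Proof. by rewrite mulr_ge0 ?Lf_ge0 ?exprn_ge0. Qed.

Lemma smoothL_gt0 : 0 < smoothL r.
Proof.
have := lt_le_trans (ac_eta hk) (ps_eta ps).
by rewrite div1r invr_gt0.
Qed.

Lemma step_le : smoothL r * eta k <= 1.
Proof.
have := ps_eta ps; rewrite div1r -(ler_pM2l smoothL_gt0) mulfV // gt_eqF //.
exact: smoothL_gt0.
Qed.

(** The modulus is at most L as soon as the parameter set has two points, mu is
    below the modulus, and L eta <= 1. *)
Lemma mu_eta_lt1 : mu k * eta k < 1.
Proof.
apply: lt_le_trans step_le; rewrite ltr_pM2r ?(ac_eta hk) //.
apply: lt_le_trans (mu_lt_modulus st) _.
exact: (modulus_le_smooth st (ltnSn H) (ps_cost ps SN) (ps_L ps SN) SX SY XY).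
Qed.

Definition truncation_budget : R :=
  H%:R * (cG k * D * (4 * D))
  + T%:R * (cG k * D * ((1 + kappa k) * (kappa k ^+ 2 * (1 - gamma k) ^+ H.+1 * D))).

Let GD0 : 0 <= cG k * D. Proof. exact: (cGD_ge0 st (ps_cost ps SN)). Qed.
Let D0 : 0 <= D. Proof. exact: (radius_ge0 st). Qed.

Lemma total_truncation (N : nat -> dac) : (forall s, dac_set k (N s)) ->
  `|\sum_(1 <= t < T.+1) expected_cost S N t - \sum_(1 <= t < T.+1) loss S t N| <=
  truncation_budget.
Proof.
move=> hN; rewrite -sumrB; apply: le_trans (ler_norm_sum _ _ _) _.
have [g0 g1] := andP g01.
have a0 : 0 <= cG k * D * (4 * D) by apply: mulr_ge0 => //; exact: mulr_ge0.
have q0 : 0 <= cG k * D * ((1 + kappa k) * (kappa k ^+ 2 * (1 - gamma k) ^+ H.+1 * D)).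
  apply: mulr_ge0 => //; apply: mulr_ge0; first exact: addr_ge0.
  apply: mulr_ge0 => //; apply: mulr_ge0; first exact: exprn_ge0.
  by rewrite exprn_ge0 ?subr_ge0.
apply: early_sum => // t tT; case: ifP => tH.
  rewrite -[leLHS]addr0 lerD //; apply: (truncation_early st hN); first by case/andP: tT.
  exact/(ps_cost ps)/inT.
rewrite add0r; apply: (truncation_late st hN); first by rewrite ltnNge tH.
exact/(ps_cost ps)/inT.
Qed.

(** The factor 2 lambda: each distance enters two consecutive moves of the path
    length. *)
Lemma gRH_lipschitz (N M : nat -> dac) : N 0%N = M 0%N ->
  (forall s, (s <= T)%N -> dac_set k (N s)) -> (forall s, (s <= T)%N -> dac_set k (M s)) ->
  gRH S lam T N - gRH S lam T M <=
  (c * H.+2%:R + 2 * lam) * \sum_(1 <= t < T.+1) fnorm (N t - M t).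
Proof.
move=> e0 hN hM; rewrite /gRH opprD addrACA -sumrB -mulrBr mulrDl.
set V := \sum_(1 <= t < T.+1) fnorm (N t - M t).
apply: lerD.
  rewrite /V mulr_sumr big_nat [leRHS]big_nat; apply: ler_sum => t tT.
  apply: le_trans (ler_norm _) _.
  have [t1 tT'] := andP tT.
  exact: (surrogate_lipschitz st t1 (ps_Lf ps (inT tT)) Lf_ge0 (hN t tT') (hM t tT')).
have -> : 2 * lam * V = lam * (2 * V) by ring.
rewrite ler_wpM2l ?lambda_ge0 // /path_length -sumrB.
have shift : \sum_(1 <= t < T.+1) fnorm (N t.-1 - M t.-1) <= V.
  rewrite big_add1 /= big_ltn // e0 subrr fnorm0 add0r /V.
  have -> : \sum_(1 <= t < T) fnorm (N t - M t) = \sum_(1 <= t < T) fnorm (N t - M t) + 0 by rewrite addr0.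
  by rewrite [leRHS]big_nat_recr //= lerD2l fnorm_ge0.
rewrite mulr_natl mulr2n; apply: le_trans (lerD (lexx V) shift).
rewrite /V -big_split /=; apply: ler_sum => t _.
have E (a b x y : dac) : a - b = (a - x) + (y - b) + (x - y).
  by apply/matrixP => i j; rewrite !mxE; ring.
rewrite lerBlDr [N t - N t.-1](E _ _ (M t) (M t.-1)) [fnorm (N t.-1 - _)]fnormBC.
by apply: le_trans (fnormD _ _) _; rewrite lerD2r fnormD.
Qed.

Hypothesis hrho : rho k ^+ W <= T%:R^-1.

(** Up to time H the optimization error is only bounded by the diameter; after it
    the contraction over W steps applies to the whole window. *)
Lemma executed_minloc t : (1 <= t <= T)%N ->
  fnorm (executed r t - blk (minloc r t) 0) <=
  (if (t <= H)%N then 2 * dac_radius dx k H else 0)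
  + W%:R * (2 * dac_radius dx k H) / T%:R.
Proof.
move=> tT; have dr0 := dac_radius_ge0 dx H k0 b0.
have q0 : 0 <= W%:R * (2 * dac_radius dx k H) / T%:R by rewrite !mulr_ge0 ?invr_ge0.
have mloc := ps_minloc ps tT; have Sloc := mloc.1.
case: ifP => tH.
  rewrite -[leLHS]addr0 lerD //; apply: dac_set_diameter => //.
    by apply: executed_dac; case/andP: tT.
  exact: Sloc.
rewrite add0r; have [_ _ eT] := ps_poc ps.
have [Z [Z0 mZ ->]] := eT t tT.
rewrite -blkB; apply: le_trans (fnorm_blk _ _) _.
have SZ0 : window_set k (Z 0%N).
  move=> j jW; rewrite Z0 //; apply: ogd_dac.
  by have /andP[-> h] := window_index tT jW; exact: leqW.
have tj j := @window_index T W t j tT.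
have Ht : (H < t)%N by rewrite ltnNge tH.
have := @window_iterates _ _ _ _ _ _ st W (smoothL r) lam t Ht
  (fun j jW => ps_cost ps (tj j jW)) (fun j jW => ps_L ps (tj j jW))
  lambda_ge0 step_le (ltW mu_eta_lt1) _ _ Z _ SZ0 mZ mloc W (leqnn W).
move/le_trans; apply; rewrite [leRHS]mulrC; apply: ler_pM => //.
- by rewrite exprn_ge0 // sqrtr_ge0.
- exact: fnorm_ge0.
- exact: window_set_diameter.
Qed.

Lemma tracking_error :
  \sum_(1 <= t < T.+1) fnorm (executed r t - minRH r t) <=
  2 * dac_radius dx k H * (H%:R + W%:R) + \sum_(1 <= t < T.+1) window_error r t.
Proof.
apply: (@le_trans _ _ (\sum_(1 <= t < T.+1)
   (fnorm (executed r t - blk (minloc r t) 0) + window_error r t))).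
  by apply: ler_sum => t _; exact: fnorm_triangle.
rewrite big_split /= lerD2r.
have dr0 := dac_radius_ge0 dx H k0 b0.
apply: le_trans (early_sum _ _ executed_minloc) _; rewrite ?mulr_ge0 ?invr_ge0 //.
have Tn : (T%:R : R) != 0 by rewrite pnatr_eq0 -lt0n.
by rewrite [T%:R * _]mulrC divfK // -mulrDl mulrC.
Qed.

Lemma regret_bound :
  (expected_regret S T (executed r) (comparator r) <=
   (2 * truncation_budget + 2 * lam * path_length (comparator r) T
    + (c * H.+2%:R + 2 * lam) *
      (2 * dac_radius dx k H * (H%:R + W%:R)
       + \sum_(1 <= t < T.+1) window_error r t))%:E)%E.
Proof.
(* Sequences are constrained up to time T only: stopping them at T makes them
   admissible at all times without changing the regret. *)
pose N s := executed r (minn s T); pose M s := comparator r (minn s T).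
have eN s : (s <= T)%N -> executed r s = N s by move=> sT; rewrite /N (minn_idPl sT).
have eM s : (s <= T)%N -> comparator r s = M s by move=> sT; rewrite /M (minn_idPl sT).
have hN s : dac_set k (N s) by apply: executed_dac; exact: geq_minr.
have hM s : dac_set k (M s) by apply: comparator_dac; exact: geq_minr.
rewrite (expected_regret_local S eN eM) (expected_regretE st hN hM); last first.
  by move=> t tT; exact/(ps_cost ps)/inT.
rewrite (path_length_local eM) lee_fin.
have lip t : (1 <= t <= T)%N -> coord_lipschitz k S H c t by move=> tT; exact/(ps_Lf ps)/inT.
have t1 := le_trans (ler_norm _) (total_truncation hN).
have s1 := le_trans (ler_norm _) (total_loss_surrogate st Lf_ge0 lip hN).
have t2 := total_truncation hM; rewrite distrC in t2.
have {}t2 := le_trans (ler_norm _) t2.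
have s2 := total_loss_surrogate st Lf_ge0 lip hM; rewrite distrC in s2.
have {}s2 := le_trans (ler_norm _) s2.
have [[m0 mT] mmin] := ps_minRH ps.
have g1 : gRH S lam T (minRH r) <= gRH S lam T M.
  by rewrite -(gRH_local S lam eM); apply: mmin; exact: ps_comp ps.
have g2 : gRH S lam T N - gRH S lam T (minRH r) <= (c * H.+2%:R + 2 * lam) *
    (2 * dac_radius dx k H * (H%:R + W%:R) + \sum_(1 <= t < T.+1) window_error r t).
  rewrite -(gRH_local S lam eN).
  have [_ e0 _] := ps_poc ps.
  apply: le_trans (gRH_lipschitz _ executed_dac minRH_dac) _; first by rewrite e0 m0.
  rewrite ler_wpM2l ?tracking_error //.
  by rewrite addr_ge0 ?mulr_ge0 ?Lf_ge0 ?lambda_ge0.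
rewrite -/lam in s1 s2; move: t1 t2 s1 s2 g1 g2; rewrite /gRH.
lra.
Qed.

End regret.

(** * Logarithmic horizons *)

Section horizons.
Context (R : realType).

Lemma horizon_natr (a : R) T : 0 <= a -> (0 < T)%N ->
  (horizon a T)%:R = (Num.ceil (a * ln T%:R))%:~R :> R.
Proof.
move=> a0 T0; rewrite /horizon natr_absz ger0_norm // ceil_ge0.
by rewrite (lt_le_trans (ltrN10 R)) // mulr_ge0 // ln_ge0 // ler1n.
Qed.

Lemma horizon_ge (a : R) T : 0 <= a -> (0 < T)%N -> a * ln T%:R <= (horizon a T)%:R.
Proof. by move=> a0 T0; rewrite horizon_natr // ceil_ge. Qed.

Lemma horizon_le (a : R) T : 0 <= a -> (0 < T)%N -> (horizon a T)%:R <= a * ln T%:R + 1.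
Proof.
move=> a0 T0; rewrite horizon_natr //.
have /andP[h _] := ceil_itv (a * ln T%:R).
by rewrite -lerBlDr; apply: ltW; move: h; rewrite intrB mulr1z.
Qed.

(** This is what the lower bounds on c_H and c_W are for: a power with a
    logarithmic exponent becomes 1/T. *)
Lemma pow_horizon_le (a q : R) T : 0 < q < 1 -> 1 / `|ln q| <= a -> (0 < T)%N ->
  q ^+ horizon a T <= T%:R^-1.
Proof.
move=> q01 qa T0; have [q0 _] := andP q01.
have lq := ln_lt0 q01; have nq : 0 < `|ln q| by rewrite normr_gt0 lt_eqF.
have lT : 0 <= ln (T%:R : R) by rewrite ln_ge0 // ler1n.
have a0 : 0 <= a by apply: le_trans qa; rewrite div1r invr_ge0.
rewrite -{1}(lnK (x := q)) // -expRM_natl -[T%:R in leRHS](lnK (x := T%:R)); last by rewrite posrE ltr0n.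
rewrite -expRN ler_expR lerNr -mulrN -(ltr0_norm lq).
apply: le_trans (ler_wpM2r (ltW nq) (horizon_ge a0 T0)).
rewrite mulrAC ler_peMl // -ler_pdivrMr //.
Qed.

End horizons.

(** * Powers of a common scale *)

Section monomials.
Context (R : realType) (X : R).
Hypothesis X2 : 2 <= X.

(** Nonnegativity is carried along so that products of bounds are bounds of
    products. *)
Definition bounded (n : nat) (a : R) := 0 <= a <= X ^+ n.

Let X1 : 1 <= X. Proof. by apply: le_trans X2; rewrite ler1n. Qed.
Let X0 : 0 <= X. Proof. exact: le_trans ler01 X1. Qed.

Lemma boundedM m n a b : bounded m a -> bounded n b -> bounded (m + n) (a * b).
Proof.
move=> /andP[a0 aX] /andP[b0 bX]; rewrite /bounded mulr_ge0 //= exprD.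
exact: ler_pM.
Qed.

Lemma boundedW m n a : (m <= n)%N -> bounded m a -> bounded n a.
Proof.
move=> mn /andP[a0 aX]; rewrite /bounded a0 /=; apply: le_trans aX _.
by rewrite ler_weXn2l.
Qed.

Lemma boundedD n a b : bounded n a -> bounded n b -> bounded n.+1 (a + b).
Proof.
move=> /andP[a0 aX] /andP[b0 bX]; rewrite /bounded addr_ge0 //= exprS.
apply: le_trans (ler_wpM2r (exprn_ge0 n X0) X2).
by rewrite mulr_natl mulr2n lerD.
Qed.

Lemma boundedX n p a : bounded n a -> bounded (n * p) (a ^+ p).
Proof.
move=> /andP[a0 aX]; rewrite /bounded exprn_ge0 //= exprM.
by rewrite lerXn2r ?nnegrE ?exprn_ge0.
Qed.

Lemma bounded1 a : 0 <= a -> a <= X -> bounded 1 a.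
Proof. by move=> a0 aX; rewrite /bounded a0 expr1. Qed.

Lemma bounded_le n a b : 0 <= a -> a <= b -> bounded n b -> bounded n a.
Proof. by move=> a0 ab /andP[_ bX]; rewrite /bounded a0 (le_trans ab). Qed.

End monomials.

Lemma collect_terms (R : realType) (z a l p c b e : R) :
  a + c * b <= z -> l * p <= z * p -> c * e <= z * e ->
  a + l * p + c * (b + e) <= z * (1 + p + e).
Proof. lra. Qed.

(** * The regret bound as a power of log T *)

Section polylog.
Context (R : realType) (dx : nat) (k : constants R).
Hypothesis hk : admissible_constants k.

(** A common scale: every constant of the problem is at most this number, so
    that its product with log T dominates each factor of the regret bound at once. *)
Definition scale : R :=
  10 + `|kappa k| + `|cG k| + `|wbar k| + `|kB k| + (gamma k)^-1 + `|cH k| + `|cW k| + dx%:R.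

(** The exponential makes the memory H shorter than T; the other term makes the
    denominator in D at least 1/2. *)
Definition threshold : R := expR (4 * (cH k + 3)) + 2 * kappa k ^+ 2.

Lemma cH_ge0 : 0 <= cH k.
Proof. by apply: le_trans (ac_cH hk); rewrite div1r invr_ge0. Qed.

Lemma cW_ge0 : 0 <= cW k.
Proof. by apply: le_trans (ac_cW hk); rewrite div1r invr_ge0. Qed.

Context (T : nat).
Hypothesis hT : threshold <= T%:R.

Lemma T_ge_exp : expR (4 * (cH k + 3)) <= T%:R.
Proof. by apply: le_trans hT; rewrite /threshold lerDl mulr_ge0 ?sqr_ge0. Qed.

Lemma T_gt0 : (0 < T)%N.
Proof. by rewrite -(ltr0n R) (lt_le_trans _ T_ge_exp) ?expR_gt0. Qed.

Lemma lnT_ge : 4 * (cH k + 3) <= ln T%:R.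
Proof.
rewrite -[leLHS]expRK ler_ln ?T_ge_exp // posrE ?expR_gt0 //.
by rewrite ltr0n T_gt0.
Qed.

Lemma lnT_ge1 : 1 <= ln (T%:R : R).
Proof. by apply: le_trans lnT_ge; have := cH_ge0; lra. Qed.

(** With l = log T, T is the square of e^(l/2) >= 1 + l/2, and l >= 4 (c_H + 3). *)
Lemma memory_short : ((horizon (cH k) T).+2 <= T)%N.
Proof.
rewrite -(ler_nat R) -addn2 natrD.
have h := horizon_le cH_ge0 T_gt0.
have c0 := cH_ge0; have l1 := lnT_ge1; have l4 := lnT_ge.
set l := ln (T%:R : R) in h l1 l4.
have e : T%:R = expR (l / 2) * expR (l / 2) :> R.
  by rewrite -expRD -splitr lnK // posrE ltr0n T_gt0.
have g := expR_ge1Dx (l / 2).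
have : (1 + l / 2) * (1 + l / 2) <= expR (l / 2) * expR (l / 2).
  by apply: ler_pM => //; lra.
rewrite -e; have : l * (4 * (cH k + 3)) <= l * l by rewrite ler_wpM2l //; lra.
have : 1 * (cH k + 3) <= l * (cH k + 3) by rewrite ler_wpM2r //; lra.
nra.
Qed.

Local Notation X := (scale * ln T%:R).

Lemma gammaV_ge0 : 0 <= (gamma k)^-1.
Proof. by rewrite invr_ge0 ltW //; case/andP: (ac_gamma hk). Qed.

Lemma scale_ge : 10 <= scale.
Proof.
rewrite /scale; have := gammaV_ge0; have := ler0n R dx.
have := normr_ge0 (kappa k); have := normr_ge0 (cG k); have := normr_ge0 (wbar k).
have := normr_ge0 (kB k); have := normr_ge0 (cH k); have := normr_ge0 (cW k).
lra.
Qed.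

Lemma le_scale a : a <= scale -> a <= X.
Proof.
move=> h; apply: le_trans h _; rewrite ler_peMr ?lnT_ge1 //.
exact: le_trans scale_ge.
Qed.

Lemma X_ge10 : 10 <= X. Proof. exact/le_scale/scale_ge. Qed.

Lemma constants_le_scale :
  [/\ `|kappa k| <= X, `|cG k| <= X, `|wbar k| <= X, `|kB k| <= X &
   [/\ (gamma k)^-1 <= X & dx%:R <= X]].
Proof.
have := gammaV_ge0; have := ler0n R dx.
have := normr_ge0 (kappa k); have := normr_ge0 (cG k); have := normr_ge0 (wbar k).
have := normr_ge0 (kB k); have := normr_ge0 (cH k); have := normr_ge0 (cW k).
by split; [| | | |split]; apply: le_scale; rewrite /scale; lra.
Qed.

Lemma horizon_le_scale a : 0 <= a -> a + 3 <= scale -> (horizon a T)%:R + 2 <= X.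
Proof.
move=> a0 aS; apply: le_trans (ler_wpM2r _ aS); last first.
  exact: le_trans ler01 lnT_ge1.
by have := horizon_le a0 T_gt0; have := lnT_ge1; lra.
Qed.

Lemma H_le : (horizon (cH k) T)%:R + 2 <= X.
Proof.
apply: horizon_le_scale; first exact: cH_ge0.
rewrite /scale (ger0_norm cH_ge0).
have := gammaV_ge0; have := ler0n R dx.
have := normr_ge0 (kappa k); have := normr_ge0 (cG k); have := normr_ge0 (wbar k).
have := normr_ge0 (kB k); have := normr_ge0 (cW k).
lra.
Qed.

Lemma W_le : (horizon (cW k) T)%:R + 2 <= X.
Proof.
apply: horizon_le_scale; first exact: cW_ge0.
rewrite /scale (ger0_norm cW_ge0).
have := gammaV_ge0; have := ler0n R dx.
have := normr_ge0 (kappa k); have := normr_ge0 (cG k); have := normr_ge0 (wbar k).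
have := normr_ge0 (kB k); have := normr_ge0 (cH k).
lra.
Qed.

Local Notation H := (horizon (cH k) T).
Local Notation W := (horizon (cW k) T).

Lemma damping_le : (1 - gamma k) ^+ H.+1 <= T%:R^-1.
Proof.
have [g0 g1] := andP (ac_gamma hk).
have q : 0 < 1 - gamma k < 1 by rewrite subr_gt0 g1 gtrBl g0.
apply: le_trans (pow_horizon_le q (ac_cH hk) T_gt0).
rewrite exprS ler_piMl ?exprn_ge0 ?subr_ge0 ?(ltW g1) //.
by rewrite gerBl ltW.
Qed.

Lemma radius_denominator : 1 / 2 <= 1 - kappa k ^+ 2 * (1 - gamma k) ^+ H.+1.
Proof.
have Tp : 0 < T%:R :> R by rewrite ltr0n T_gt0.
have h : kappa k ^+ 2 * (1 - gamma k) ^+ H.+1 <= kappa k ^+ 2 / T%:R.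
  by rewrite ler_wpM2l ?sqr_ge0 ?damping_le.
have : kappa k ^+ 2 / T%:R <= 1 / 2.
  rewrite ler_pdivrMr // mul1r mulrC ler_pdivlMr // mulrC.
  by apply: le_trans hT; rewrite /threshold lerDr expR_ge0.
move=> h2; rewrite lerBrDr -lerBrDl; apply: le_trans h (le_trans h2 _).
by rewrite lerBrDl -splitr.
Qed.

Context (du : nat) (S : problem R dx du) (r : run R dx du H W).
Hypothesis ps : poc_setting k T S r.

Lemma standing_long : standing k S H.
Proof.
split; [exact: hk|exact: ps_noise ps|exact: ps_stable ps|].
by apply: lt_le_trans radius_denominator; rewrite div1r invr_gt0.
Qed.

Let st := standing_long.

Lemma regret_polylog :
  (expected_regret S T (executed r) (comparator r) <=
   (X ^+ 36 * (1 + path_length (comparator r) T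
    + \sum_(1 <= t < T.+1) window_error r t))%:E)%E.
Proof.
have X10 := X_ge10; have X2 : 2 <= X by apply: le_trans X10; rewrite ler_nat.
have P0 : 0 <= path_length (comparator r) T.
  by apply: sumr_ge0 => t _; exact: fnorm_ge0.
have E0 : 0 <= \sum_(1 <= t < T.+1) window_error r t.
  by apply: sumr_ge0 => t _; exact: fnorm_ge0.
set P := path_length _ _ in P0 *; set E := \sum_(1 <= t < T.+1) _ in E0 *.
have [[U [V [SU SV UV]]]|triv] := pselect (exists U V : blocks R H du dx,
    [/\ dac_set k U, dac_set k V & U != V]); last first.
  rewrite (regret_trivial hk ps); last first.
    move=> U V SU SV; apply/eqP/negPn/negP => UV; apply: triv.
    by exists U, V.
  rewrite lee_fin mulr_ge0 ?exprn_ge0 ?addr_ge0 //.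
  exact: le_trans X2.
have HT : (H < (T + W).-1)%N by have := memory_short; lia.
have mu1 := mu_eta_lt1 hk ps st HT SU SV UV.
have muk0 : 0 < mu k.
  have [g0 _] := andP (ac_gamma hk).
  have kap := lt_le_trans ltr01 (ac_kappa hk).
  by rewrite divr_gt0 ?mulr_gt0 ?exprn_gt0 ?(ac_alpha hk) ?(ac_sigma hk).
have rho01 : 0 < rho k < 1.
  rewrite sqrtr_gt0 subr_gt0 mu1 /= -[X in _ < X]sqrtr1 ltr_sqrt //.
  by rewrite gtrBl mulr_gt0 ?(ac_eta hk).
have W0 : (0 < W)%N.
  have : 0 < cW k.
    apply: lt_le_trans (ac_cW hk).
    by rewrite div1r invr_gt0 normr_gt0 lt_eqF // ln_lt0.
  move=> c0; rewrite -(ltr0n R); apply: lt_le_trans (horizon_ge (ltW c0) T_gt0).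
  by rewrite mulr_gt0 // (lt_le_trans ltr01 lnT_ge1).
have hrho := pow_horizon_le rho01 (ac_cW hk) T_gt0.
apply: le_trans (regret_bound hk ps st T_gt0 W0 HT SU SV UV hrho) _.
rewrite lee_fin -/P -/E.
have [kX GX wX bX [gX dX]] := constants_le_scale.
have hH := H_le; have hW := W_le.
have k0 : 0 <= kappa k by exact: kappa_ge0 st.
have b0 : 0 <= kB k by exact: kB_ge0 st.
have w0 : 0 <= wbar k by exact: wbar_ge0 st.
rewrite (ger0_norm k0) in kX; rewrite (ger0_norm b0) in bX; rewrite (ger0_norm w0) in wX.
have Bk : bounded X 1 (kappa k) by exact: bounded1.
have Bb : bounded X 1 (kB k) by exact: bounded1.
have Bw : bounded X 1 (wbar k) by exact: bounded1.
have Bg : bounded X 1 (gamma k)^-1 by apply: bounded1 => //; exact: gammaV_ge0.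
have Bdx : bounded X 1 dx%:R by exact: bounded1.
have BH : bounded X 1 H%:R by apply: bounded1 => //; apply: le_trans hH; rewrite lerDl.
have BH2 : bounded X 1 H.+2%:R.
  by apply: bounded1 => //; rewrite -addn2 natrD.
have BW : bounded X 1 W%:R by apply: bounded1 => //; apply: le_trans hW; rewrite lerDl.
have Bn (n : nat) : (n <= 10)%N -> bounded X 1 n%:R.
  move=> n10; apply: bounded1 => //; apply: le_trans X10.
  by rewrite ler_nat.
have B1 : bounded X 0 1 by rewrite /bounded ler01 expr0 lexx.
have Bk3 : bounded X 3 (kappa k ^+ 3) := boundedX X2 3 Bk.
have D0 := radius_ge0 st.
have den := radius_denominator; set dn := 1 - _ in den.
have dn0 : 0 < dn by apply: lt_le_trans den; rewrite div1r invr_gt0.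
have Bden : bounded X 1 dn^-1.
  apply: bounded1; first by rewrite invr_ge0 ltW.
  apply: le_trans X2; rewrite -[leRHS]invrK lef_pV2 ?posrE ?invr_gt0 //.
  by rewrite -div1r.
have BD : bounded X 14 (radiusD k H).
  rewrite /radiusD -/dn invfM.
  have B := boundedM (boundedM (boundedM Bw Bk3)
    (boundedD X2 (boundedW X2 (leq0n 6) B1)
       (boundedM (boundedM BH (boundedX X2 2 Bb)) Bk3)))
    (boundedM Bg Bden).
  have B' := boundedM (boundedM (boundedM Bb Bk3) Bw) Bg.
  exact: (boundedD X2 B (boundedW X2 (isT : (6 <= 13)%N) B')).
have GD0 : 0 <= cG k * radiusD k H.
  have h : (1 <= H.+1 <= (T + W).-1)%N by [].
  exact: (cGD_ge0 st (ps_cost ps h)).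
have BGD : bounded X 15 (cG k * radiusD k H).
  apply: (@bounded_le _ _ _ _ (`|cG k| * radiusD k H)) => //.
    by rewrite ler_wpM2r // ler_norm.
  by apply: (boundedM (bounded1 _ _) BD).
have c0 := Lf_ge0 ps HT SU SV UV.
have Bs : bounded X 1 (Num.sqrt H%:R).
  apply: bounded1; first exact: sqrtr_ge0.
  have X0 : 0 <= X by exact: le_trans X2.
  rewrite -[leRHS](ger0_norm X0) -sqrtr_sqr ler_wsqrtr // expr2.
  case/andP: BH => h0; rewrite expr1 => h1; apply: le_trans h1 _.
  by rewrite ler_peMl // (le_trans _ X2) // ler1n.
have Bc : bounded X 22 (Lf r).
  apply: (bounded_le c0 (ps_Lf_le ps)).
  have -> : Lf_bound k H = 3 * Num.sqrt H%:R * (cG k * radiusD k H) * wbar k * kB k * kappa k ^+ 3.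
    by rewrite /Lf_bound; ring.
  exact: (boundedM (boundedM (boundedM (boundedM
    (boundedM (Bn 3 isT) Bs) BGD) Bw) Bb) Bk3).
have Bl : bounded X 24 (lambda r).
  exact: (boundedM (boundedX X2 2 BH2) Bc).
have Btau : bounded X 34 (truncation_budget k T H).
  have Tp : 0 < T%:R :> R by rewrite ltr0n T_gt0.
  have [g0 g1] := andP (ac_gamma hk).
  have BTd : bounded X 0 (T%:R * (1 - gamma k) ^+ H.+1).
    rewrite /bounded expr0 mulr_ge0 ?exprn_ge0 ?subr_ge0 ?(ltW g1) //=.
    by rewrite mulrC -ler_pdivlMr // div1r damping_le.
  have -> : truncation_budget k T H = H%:R * (cG k * radiusD k H * (4 * radiusD k H)) +
      cG k * radiusD k H * ((1 + kappa k) * (kappa k ^+ 2 *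
        (T%:R * (1 - gamma k) ^+ H.+1) * radiusD k H)).
    rewrite /truncation_budget; congr (_ + _); rewrite mulrCA; congr (_ * _).
    by rewrite mulrCA; congr (_ * _); rewrite [LHS]mulrA; congr (_ * _); exact: mulrCA.
  have B := boundedM BH (boundedM BGD (boundedM (Bn 4 isT) BD)).
  have B' := boundedM BGD (boundedM (boundedD X2 (boundedW X2 (leq0n 1) B1) Bk)
    (boundedM (boundedM (boundedX X2 2 Bk) BTd) BD)).
  exact: (boundedD X2 (boundedW X2 (isT : (31 <= 33)%N) B) B').
have Bl2 : bounded X 25 (2 * lambda r) := boundedM (Bn 2 isT) Bl.
have Bcl : bounded X 26 (Lf r * H.+2%:R + 2 * lambda r).
  exact: (boundedD X2 (boundedW X2 (isT : (23 <= 25)%N) (boundedM Bc BH2)) Bl2).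
have Bdr : bounded X 9 (2 * dac_radius dx k H * (H%:R + W%:R)).
  exact: (boundedM (boundedM (Bn 2 isT)
    (boundedM (boundedM BH Bdx) (boundedM Bk3 Bb))) (boundedD X2 BH BW)).
have /andP[_ f0] := boundedD X2 (boundedM (Bn 2 isT) Btau) (boundedM Bcl Bdr).
have /andP[_ f1] := boundedW X2 (isT : (25 <= 36)%N) Bl2.
have /andP[_ f2] := boundedW X2 (isT : (26 <= 36)%N) Bcl.
have h1 := ler_wpM2r P0 f1; have h2 := ler_wpM2r E0 f2.
exact: collect_terms f0 h1 h2.
Qed.

End polylog.

(** * Dynamic regret, without and with decay of sensitivity *)

Theorem mainTheorem2 (R : realType) (dx du : nat) (k : constants R)
    (hk : admissible_constants k) :
  (exists (C : R) (p T0 : nat),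
    forall T : nat, (T0 <= T)%N ->
    let H := horizon (cH k) T in
    let W := horizon (cW k) T in
    forall (S : problem R dx du) (r : run R dx du H W),
      poc_setting k T S r ->
      (expected_regret S T (executed r) (comparator r) <=
       (C * ln T%:R ^+ p *
        (1 + path_length (comparator r) T
         + \sum_(1 <= t < T.+1) window_error r t))%:E)%E)
  /\
  (forall CEDS xi : R, 0 < CEDS -> 0 < xi < 1 -> 1 / `|ln xi| <= cW k ->
   exists (C : R) (p T0 : nat),
    forall T : nat, (T0 <= T)%N ->
    let H := horizon (cH k) T in
    let W := horizon (cW k) T in
    forall (S : problem R dx du) (r : run R dx du H W),
      poc_setting k T S r ->
      (forall t : nat, (1 <= t <= T)%N -> window_error r t <= CEDS * xi ^+ W) ->
      (expected_regret S T (executed r) (comparator r) <=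
       (C * ln T%:R ^+ p * (1 + path_length (comparator r) T))%:E)%E).
Proof.
have thr0 : 0 <= threshold k.
  by apply: addr_ge0; [exact: expR_ge0 | rewrite mulr_ge0 ?sqr_ge0].
pose T0 := Num.bound (threshold k).
have hT T : (T0 <= T)%N -> threshold k <= T%:R.
  move=> T0T; apply: ltW; apply: lt_le_trans (archi_boundP thr0) _.
  by rewrite ler_nat.
split.
  exists (scale dx k ^+ 36), 36%N, T0 => T T0T H W S r ps.
  by rewrite -exprMn; exact: (regret_polylog hk (hT T T0T) ps).
move=> CEDS xi C0 xi01 xiW.
exists (scale dx k ^+ 36 * (1 + CEDS)), 36%N, T0 => T T0T H W S r ps eds.
have Tp := T_gt0 (hT T T0T).
have l1 := lnT_ge1 hk (hT T T0T).
apply: le_trans (regret_polylog hk (hT T T0T) ps) _; rewrite lee_fin.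
set P := path_length _ _; have P0 : 0 <= P by apply: sumr_ge0 => t _; exact: fnorm_ge0.
have E : \sum_(1 <= t < T.+1) window_error r t <= CEDS.
  apply: (@le_trans _ _ (\sum_(1 <= t < T.+1) CEDS / T%:R)).
    rewrite big_nat [leRHS]big_nat; apply: ler_sum => t tT; apply: le_trans (eds t tT) _.
    by rewrite ler_wpM2l ?(ltW C0) // (pow_horizon_le xi01 xiW Tp).
  rewrite sumr_const_nat subSS subn0 -[leLHS]mulr_natr divfK // pnatr_eq0 -lt0n //.
rewrite -[_ ^+ 36 * _ * _ * _]mulrA.
have -> : scale dx k ^+ 36 * (1 + CEDS) * (ln T%:R ^+ 36 * (1 + P)) =
  (scale dx k * ln T%:R) ^+ 36 * ((1 + CEDS) * (1 + P)) by rewrite exprMn; ring.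
rewrite ler_wpM2l //.
  apply: exprn_ge0; apply: mulr_ge0; last exact: le_trans l1.
  exact: le_trans (scale_ge dx hk).
have : 0 <= CEDS * P by rewrite mulr_ge0 // ltW.
lra.
Qed.
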